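(* For a prime power $q$ and integers $n\ge 2$, $1\le m\le n$, let $x=x_{n,m}>0$ be the unique positive real with $\sum_{j=1}^m x^j=n$, and let $G_q$ (depending on $q$ and $m$) be the function defined in the context. (i) Along any sequence of triples $(q,n,m)$ with $(m-2\log_q n)\log q\to\infty$, one has $G_q(x)\to 1$, and in particular, in this limit, $\mathbb{P}(f_n\text{ is }m\text{-smooth})/\mathbb{P}(\pi_n\text{ is }m\text{-smooth})\to 1$. (ii) For every prime power $q$ and every $A>0$ there is a constant $c=c(q,A)>0$ such that $G_q(x)-1\ge c$ for all $n\ge 2$, $1\le m\le n$ with $|m-2\log_q n|\le A$. (iii) Let $q$ be a fixed prime power and $\varepsilon\in(0,1)$. If $n\to\infty$ and $m=m(n)$ is such that $m/\log_q n\to 2-\varepsilon$, then $\log G_q(x)=\Theta_q\big(n^{\varepsilon+o(1)}\big)$.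
   Context: $\log$ is the natural logarithm and $\log_q$ is the base-$q$ logarithm. $\Theta_q(Y)$ denotes a quantity lying between $c_qY$ and $C_qY$ for constants $0<c_q\le C_q$ depending only on $q$. $\pi_n$ is a uniformly random permutation in the symmetric group $S_n$. $f_n=f_{n,q}$ is a uniformly random element of the set of monic polynomials of degree $n$ over the finite field $\mathbb{F}_q$. A permutation is $m$-smooth if all its cycles have length at most $m$. A polynomial over $\mathbb{F}_q$ is $m$-smooth if all its irreducible factors have degree at most $m$. For $|z|<q$, $$G_q(z)=\prod_{\substack{P\in\mathbb{F}_q[T]\text{ monic irreducible}\\ \deg P\le m}}\left(1-\left(\frac zq\right)^{\deg P}\right)^{-1}\exp\left(-\sum_{i=1}^m\frac{z^i}{i}\right).$$
   Formalization: In (ii) the bound is stated only for those n, m with x < q, since G_q(z) is defined only for |z| < q and x can exceed q (e.g. q=3, m=1, n=4 gives x=4). *)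

(* Defs.v *)
From HB Require Import structures.
From mathcomp Require Import all_boot all_order all_algebra all_fingroup.
From mathcomp Require Import all_classical all_reals all_analysis.

Set Implicit Arguments.
Unset Strict Implicit.
Unset Printing Implicit Defensive.

Import Order.TTheory GRing.Theory Num.Theory.
Import numFieldNormedType.Exports.
Local Open Scope ring_scope.

Definition prime_power (q : nat) : Prop :=
  exists p k : nat, [/\ prime p, (0 < k)%N & q = (p ^ k)%N].

Definition logb {R : realType} (q : nat) (y : R) : R := ln y / ln q%:R.

Definition is_saddle {R : realType} (n m : nat) (x : R) : Prop :=
  0 < x /\ \sum_(1 <= j < m.+1) x ^+ j = n%:R.

(* The default value 1 is never used when n, m >= 1; see [saddleP]. *)
Definition saddle (R : realType) (n m : nat) : R :=
  xget 1 [set x : R | is_saddle n m x]%classic.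

(* {poly_m.+1 F} is the finite type of polynomials of degree <= m.
   The paper's G_q(z) is only defined for |z| < q; for other z the value below
   is meaningless. *)
Definition Gq {R : realType} (F : finFieldType) (m : nat) (z : R) : R :=
  (\prod_(P : {poly_m.+1 F} | ((P : {poly F}) \is monic) && irreducibleb P)
      (1 - (z / #|F|%:R) ^+ (size P).-1)^-1)
  * expR (- \sum_(1 <= i < m.+1) z ^+ i / i%:R).

Definition unif_prob (R : realType) (T : finType) (Om A : {pred T}) : R :=
  #|[predI Om & A]|%:R / #|Om|%:R.

Definition smooth_perm (m n : nat) (s : 'S_n) : bool :=
  [forall C in porbits s, (#|C| <= m)%N].

Definition smooth_poly (F : fieldType) (m : nat) (f : {poly F}) : Prop :=
  forall P : {poly F}, irreducible_poly P -> P %| f -> ((size P).-1 <= m)%N.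

Definition prob_perm_smooth (R : realType) (n m : nat) : R :=
  unif_prob R predT (@smooth_perm m n).

Definition monic_deg (F : finFieldType) (n : nat) : {pred {poly_n.+1 F}} :=
  [pred f : {poly_n.+1 F} | ((f : {poly F}) \is monic) && (size f == n.+1)].

Definition prob_poly_smooth (R : realType) (F : finFieldType) (n m : nat) : R :=
  unif_prob R (@monic_deg F n)
    [pred f : {poly_n.+1 F} | `[< smooth_poly m (f : {poly F}) >]].

Lemma saddle_sum_mono (R : realType) (m : nat) (x y : R) : (0 < m)%N ->
  0 < x -> x < y ->
  \sum_(1 <= j < m.+1) x ^+ j < \sum_(1 <= j < m.+1) y ^+ j.
Proof.
move=> m0 x0 xy; rewrite !(big_nat_recl m 1) //= !expr1.
apply: ltr_leD => //; apply: ler_sum => i _.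
by apply: lerXn2r; rewrite ?nnegrE ?ltW // (lt_trans x0).
Qed.

Lemma saddleP (R : realType) (n m : nat) : (0 < n)%N -> (0 < m)%N ->
  is_saddle n m (saddle R n m) /\
  forall y : R, is_saddle n m y -> y = saddle R n m.
Proof.
move=> n0 m0.
pose p : {poly R} := \sum_(1 <= j < m.+1) 'X^j - n%:R%:P.
have pE (x : R) : p.[x] = \sum_(1 <= j < m.+1) x ^+ j - n%:R.
  rewrite /p hornerD hornerN hornerC horner_sum; congr (_ - _).
  by apply: eq_bigr => i _; rewrite hornerXn.
have [x] : exists2 x : R, 0 <= x <= n%:R & root p x.
  apply: poly_ivt; rewrite ?ler0n // !pE; apply/andP; split.
    rewrite (_ : \sum_(1 <= j < m.+1) 0 ^+ j = 0) ?sub0r ?oppr_le0 ?ler0n //.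
    by rewrite big_nat big1 // => -[|i] // _; rewrite expr0n.
  rewrite (big_nat_recl m 1) //= expr1 addrAC subrr add0r.
  by apply: sumr_ge0 => i _; rewrite exprn_ge0.
move=> /andP[x0 _] /rootP; rewrite pE => /eqP; rewrite subr_eq0 => /eqP xE.
have xgt0 : 0 < x.
  rewrite lt_neqAle x0 andbT; apply/eqP => x00.
  move: xE; rewrite -x00 big_nat big1; last by move=> [|i] // _; rewrite expr0n.
  by move/esym/eqP; rewrite pnatr_eq0 => /eqP nE; rewrite nE in n0.
have spec : is_saddle n m (saddle R n m).
  exact: (@xgetI R 1 [set y : R | is_saddle n m y]%classic x (conj xgt0 xE)).
split=> // y [y0 yE]; have [s0 sE] := spec.
case: (ltgtP y (saddle R n m)) => // h.
  by have := saddle_sum_mono m0 y0 h; rewrite yE sE ltxx.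
by have := saddle_sum_mono m0 s0 h; rewrite yE sE ltxx.
Qed.

(* Main.v *)
Require Import Defs.
From HB Require Import structures.
From mathcomp Require Import all_boot all_order all_algebra all_fingroup.
From mathcomp Require Import all_classical all_reals all_analysis.
From mathcomp Require Import ring lra zify.

(** Put u = z/q and let pi(d) be the number of monic irreducible polynomials
    of degree d.  Unique factorization gives the sum of d pi(d) over the
    divisors d of N as q^N.  Inserting this in the exponential factor of G_q
    cancels the terms of degree at most m of the logarithm of the product and
    leaves, for 0 < z < q,

      log G_q(z) = sum over d <= m of pi(d) R_d,

    where R_d is the part of the series of -log (1 - u^d) beyond the power m
    of u (Gq_expR).  All terms are nonnegative.  The first exponent occurring
    in R_d is N_d, the least multiple of d above m; it is at least 2d, and
    d pi(d) lies between q^d / 2 and q^d.  So log G_q(z) is governed by the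
    numbers q^d u^(N_d), none of which exceeds (z^2/q)^(m/2) when z^2 <= q, or
    (z^2/q)^m when z^2 >= q (logG_le), while d = m alone contributes at least
    (z^2/q)^m / (4m), and the d > m/2 together at least a constant when
    (z^2/q)^m is bounded below (logG_ge_last, logG_ge_half).

    At the saddle point, x >= 1 and n/m <= x^m <= n, so (x^2/q)^m agrees with
    n^2 q^-m up to powers of m.  This yields log G_q(x) -> 0 when
    m - 2 log_q n is large, the subpolynomial accuracy n^(eps + o(1)) when
    m ~ (2 - eps) log_q n, and, since x^m >= c n for x away from 1, a constant
    lower bound when m - 2 log_q n is bounded.

    For the ratio of the two probabilities no saddle point analysis is used.
    Let p(n) and v(n) be the probabilities for permutations and polynomials.
    Their generating functions satisfy
    sum v(n) z^n = G_q(z) sum p(n) z^n and G_q has nonnegative coefficients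
    g_j with g_0 = 1, so v(n) = sum of g_j p(n-j) >= p(n).  The sequence p is
    log-concave, so with y = p(n-1)/p(n) one has p(n-j) <= y^j p(n), whence
    v(n) <= p(n) G_q(y) (smooth_ratio_le_Gq).  Log-concavity also gives
    y^m <= p(n)/p(n+m) <= n + m <= 2n (expcoef_upto_growth).  So y satisfies
    the same bound as x up to a factor 2, and G_q(y) -> 1 as well.

    Generating functions appear only through their coefficients:
    a = exp (sum of w_i z^i / i) is encoded by the recurrence
    n a_n = sum of w_i a_(n-i), which for permutations comes from removing a
    cycle (card_smooth_on) and for polynomials from writing the degree as a
    sum over prime power divisors (nsmooth_rec). *)

Set Implicit Arguments.
Unset Strict Implicit.
Unset Printing Implicit Defensive.

Import Order.TTheory GRing.Theory Num.Theory.
Import numFieldNormedType.Exports.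

(** * Permutations with bounded cycle lengths *)

Section SmoothPermCount.
Variables (T : finType) (m : nat).
Implicit Types (s t : {perm T}) (S : {set T}) (x y : T) (D : seq T).

Definition cycles_le s := [forall x, #|porbit s x| <= m].

(** Permutations of all of T that move only points of S, so that every S lives
    in one type and no transport between symmetric groups is needed: the fixed
    points outside S are cycles of length 1, harmless when m > 0. *)
Definition smooth_on S := [set s : {perm T} | perm_on S s & cycles_le s].

Lemma porbit_eq_on (A : {pred T}) s t y :
  {in A, s =1 t} -> (forall z, z \in A -> t z \in A) -> y \in A ->
  porbit s y = porbit t y.
Proof.
move=> st tA yA.
have H k : (s ^+ k)%g y = (t ^+ k)%g y /\ (t ^+ k)%g y \in A.
  elim: k => [|k [IH1 IH2]]; first by rewrite !expg0 !perm1.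
  by rewrite !expgSr !permM IH1 st // tA.
apply/finset.setP => z; apply/porbitP/porbitP => -[k ->]; exists k.
  by have [-> _] := H k.
by have [-> _] := H k.
Qed.

Lemma fcycle_porbit s D x : uniq D -> x \in D -> fcycle s D ->
  porbit s x =i D.
Proof.
move=> UD xD cD y; apply/porbitP/idP => [[k ->]|yD].
  elim: k => [|k IH]; first by rewrite expg0 perm1.
  by rewrite expgSr permM (eqP (next_cycle cD IH)) mem_next.
have := fconnect_cycle cD xD y; rewrite yD => /iter_findex <-.
by eexists; rewrite -permX.
Qed.

Lemma card_porbit_fcycle s D x : uniq D -> x \in D -> fcycle s D ->
  #|porbit s x| = size D.
Proof.
by move=> UD xD cD; rewrite (eq_card (fcycle_porbit UD xD cD)); apply/card_uniqP.
Qed.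

Lemma fcycle_traject_porbit s x : fcycle s (traject s x #|porbit s x|).
Proof.
have := iter_porbit s x; case: #|_| (card_porbit_neq0 s x) => // n _ it.
have -> : fcycle s (traject s x n.+1) =
  fpath s x (rcons (traject s (s x) n) (iter n s (s x))) by rewrite -iterSr it.
rewrite -trajectSr; exact: fpath_traject.
Qed.

Lemma traject_fcycle s x w : fcycle s (x :: w) -> traject s x (size w).+1 = x :: w.
Proof.
rewrite [fcycle _ _]/= rcons_path => /andP[/fpathE + _].
by rewrite /= => <-.
Qed.

Definition perm_of_cycle D (UD : uniq D) : {perm T} := perm (can_inj (prev_next UD)).

Lemma perm_of_cycleE D (UD : uniq D) : perm_of_cycle UD =1 next D.
Proof. by move=> x; rewrite permE. Qed.

Lemma perm_of_cycle_out D (UD : uniq D) x : x \notin D -> perm_of_cycle UD x = x.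
Proof. by rewrite perm_of_cycleE next_nth => /negbTE ->. Qed.

(** Left multiplication by the cyclic permutation D adds D as a cycle to a
    permutation t fixing D pointwise, and leaves every other cycle of t as it
    is. *)
Lemma smooth_on_mul_cycle S D (UD : uniq D) x t : x \in D -> {subset D <= S} ->
  0 < size D <= m ->
  (t \in smooth_on (S :\: [set z in D])) =
  (perm_of_cycle UD * t \in smooth_on S)%g && fcycle (perm_of_cycle UD * t)%g D.
Proof.
move=> xD DS /andP[D0 Dm].
have onD y : y \in D -> perm_of_cycle UD y \in D by move=> yD; rewrite perm_of_cycleE mem_next.
have cyc_cycle (s : {perm T}) : {in D, s =1 perm_of_cycle UD} -> fcycle s D.
  move=> sD; apply: cycle_from_next => // y yD /=.
  by rewrite sD // perm_of_cycleE eqxx.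
have tfix : perm_on (S :\: [set z in D]) t -> {in D, t =1 id}.
  by move=> pt y yD; apply: (out_perm pt); rewrite !inE yD.
have muls : {in D, t =1 id} -> {in D, (perm_of_cycle UD * t)%g =1 perm_of_cycle UD}.
  by move=> tf y yD; rewrite permM tf ?onD.
have outs y : y \notin D -> (perm_of_cycle UD * t)%g y = t y.
  by move=> yD; rewrite permM perm_of_cycle_out.
have tout : {in D, t =1 id} -> forall y, y \notin D -> t y \notin D.
  move=> tf y yD; apply: contra yD => tyD.
  by rewrite -(perm_inj (tf _ tyD)).
have orb : {in D, t =1 id} -> cycles_le (perm_of_cycle UD * t)%g = cycles_le t.
  move=> tf; apply: eq_forallb => y.
  have [yD|yD] := boolP (y \in D).
    rewrite (card_porbit_fcycle UD yD); last exact/cyc_cycle/muls.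
    rewrite Dm; symmetry; suff -> : #|porbit t y| = 1 by rewrite (leq_trans D0).
    rewrite (_ : porbit t y = [set y]) ?cards1 //.
    apply/finset.setP => z; rewrite inE; apply/porbitP/eqP => [[k ->]|->].
      by elim: k => [|k IH]; rewrite ?expg0 ?perm1 // expgSr permM IH tf.
    by exists 0; rewrite expg0 perm1.
  rewrite (@porbit_eq_on [predC D] (perm_of_cycle UD * t)%g t) //.
  by move=> z; apply: tout.
apply/idP/idP.
  rewrite !inE => /andP[pt ct]; have tf := tfix pt.
  rewrite orb // ct cyc_cycle; last exact: muls.
  rewrite !andbT; apply/fintype.subsetP => y; rewrite inE; apply: contraR => yS.
  have yD : y \notin D by apply: contra yS => /DS.
  by rewrite outs // (out_perm pt) // !inE yD.
rewrite !inE => /andP[/andP[ps cs] cD].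
have tf : {in D, t =1 id}.
  move=> y yD; have := next_cycle cD (x:=prev D y).
  rewrite mem_prev => /(_ yD); rewrite next_prev // => /eqP.
  by rewrite permM perm_of_cycleE next_prev.
rewrite -orb // cs andbT; apply/fintype.subsetP => y; rewrite !inE.
apply: contraR; rewrite negb_and negbK => /orP[yD|yS]; first by rewrite tf.
rewrite -outs; last by apply: contra yS => /DS.
by rewrite (out_perm ps).
Qed.

Lemma card_smooth_word S D x : uniq D -> x \in D -> {subset D <= S} ->
  0 < size D <= m ->
  #|[set s in smooth_on S | fcycle s D]| = #|smooth_on (S :\: [set z in D])|.
Proof.
move=> UD xD DS Dm.
rewrite -[RHS](card_imset _ (mulgI (perm_of_cycle UD))); apply: eq_card => s.
apply/idP/imsetP => [|[t]].
  rewrite inE => sP; exists ((perm_of_cycle UD)^-1 * s)%g; last by rewrite mulKVg.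
  by rewrite (smooth_on_mul_cycle _ _ xD) // mulKVg.
by rewrite (smooth_on_mul_cycle UD _ xD) // => tP ->; rewrite inE.
Qed.

(** A permutation is determined by the word x, s x, s (s x) and so on of the
    cycle through x and by what it does off that cycle; w is the tail of the
    word. *)
Lemma card_smooth_rec S x : x \in S ->
  #|smooth_on S| =
  \sum_(i < m) \sum_(w : i.-tuple T | all [in S :\ x] w && uniq w)
     #|smooth_on (S :\: [set z in x :: w])|.
Proof.
move=> xS.
rewrite -sum1_card.
pose len s := #|porbit s x|.
have -> : \sum_(s in smooth_on S) 1 =
   \sum_(i < m) \sum_(s in smooth_on S | len s == i.+1) 1.
  rewrite (exchange_big_dep (mem (smooth_on S))) /=; last by move=> i s _ /andP[].
  apply: eq_bigr => s sP; rewrite sP /=.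
  have ls : (len s).-1 < m.
    rewrite prednK ?lt0n ?card_porbit_neq0 //.
    by move: sP; rewrite inE => /andP[_ /forallP/(_ x)].
  rewrite (bigD1 (Ordinal ls)) /=; last by rewrite prednK // lt0n card_porbit_neq0.
  rewrite big1 // => j /andP[/eqP e /eqP ne]; case: ne; apply: val_inj.
  by rewrite /= e.
apply: eq_bigr => i _.
pose word s : i.-tuple T := Tuple (introT eqP (size_traject s (s x) i)).
rewrite (partition_big word (fun w : i.-tuple T => all [in S :\ x] w && uniq w)) /=; last first.
  move=> s /andP[sP /eqP ls].
  have := uniq_traject_porbit s x; rewrite -/(len s) ls /= => /andP[xn ->].
  rewrite andbT; apply/allP => y yt; rewrite !inE.
  case: eqP yt xn => [->|_] yt xn; first by rewrite yt in xn.
  have /trajectP[k _ ->] := yt.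
  move: sP; rewrite inE => /andP[ps _].
  by rewrite -iterSr; elim: k.+1 => //= n IH; rewrite perm_closed.
apply: eq_bigr => w /andP[wS uw].
have xw : x \notin (w : seq T) by apply/negP => /(allP wS) /=; rewrite !inE eqxx.
rewrite -(@card_smooth_word S (x :: w) x) ?mem_head //=; first last.
- by rewrite size_tuple.
- by move=> y; rewrite inE => /predU1P[->//|/(allP wS) /=]; rewrite !inE => /andP[].
- by rewrite xw uw.
rewrite -[RHS]sum1_card; apply: eq_bigl => s; rewrite [RHS]inE -andbA; congr andb.
apply/andP/idP => [[/eqP ls /eqP <-]|cw].
  by have := fcycle_traject_porbit s x; rewrite -/(len s) ls.
have Uxw : uniq (x :: w) by rewrite /= xw.
split; first by rewrite /len (card_porbit_fcycle Uxw) ?mem_head //= size_tuple.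
apply/eqP/val_inj => /=.
by have [] := traject_fcycle cw; rewrite size_tuple.
Qed.

Lemma smooth_on0 : 0 < m -> #|smooth_on finset.set0| = 1.
Proof.
move=> m0; rewrite (_ : smooth_on finset.set0 = [set 1%g]) ?cards1 //.
apply/finset.setP => s; rewrite !inE; apply/andP/eqP => [[ps _]|->].
  by apply/permP => y; rewrite perm1 (out_perm ps) ?inE.
split; first exact: perm_on1.
apply/forallP => y; rewrite (_ : porbit 1 y = [set y]) ?cards1 //.
apply/finset.setP => z; rewrite inE; apply/porbitP/eqP => [[k ->]|->].
  by rewrite expg1n perm1.
by exists 0; rewrite perm1.
Qed.

End SmoothPermCount.

(** * Coefficients of the exponential of a power series *)

Local Open Scope ring_scope.

Section ExpCoef.
Variable R : realFieldType.
Implicit Types (w a b : nat -> R).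

Fixpoint expcoefs w n : seq R :=
  if n is k.+1 then
    let s := expcoefs w k in
    rcons s ((\sum_(i < k.+1) w i.+1 * s`_(k - i)) / k.+1%:R)
  else [:: 1].

(** The n-th coefficient of exp (sum over i >= 1 of w i z^i / i): comparing
    coefficients in z a' = (sum of w i z^i) a gives the recurrence used here. *)
Definition expcoef w n := (expcoefs w n)`_n.

Lemma size_expcoefs w n : size (expcoefs w n) = n.+1.
Proof. by elim: n => //= n IH; rewrite size_rcons IH. Qed.

Lemma nth_expcoefs w n k : (k <= n)%N -> (expcoefs w n)`_k = expcoef w k.
Proof.
elim: n => [|n IH]; first by rewrite leqn0 => /eqP->.
rewrite leq_eqVlt ltnS => /predU1P[->//|kn] /=.
by rewrite nth_rcons size_expcoefs ltnS kn IH.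
Qed.

Lemma expcoef0 w : expcoef w 0 = 1. Proof. by []. Qed.

Lemma expcoefS w n :
  n.+1%:R * expcoef w n.+1 = \sum_(i < n.+1) w i.+1 * expcoef w (n - i).
Proof.
rewrite {1}/expcoef /= nth_rcons size_expcoefs ltnn eqxx mulrC.
rewrite divfK ?pnatr_eq0 //.
by apply: eq_bigr => i _; rewrite nth_expcoefs ?leq_subr.
Qed.

Lemma expcoef_unique w a : a 0%N = 1 ->
  (forall n, n.+1%:R * a n.+1 = \sum_(i < n.+1) w i.+1 * a (n - i)%N) ->
  a =1 expcoef w.
Proof.
move=> a0 aS; elim/ltn_ind => -[|n] IH; first by rewrite a0.
apply: (@mulfI _ n.+1%:R); first by rewrite pnatr_eq0.
by rewrite aS expcoefS; apply: eq_bigr => i _; rewrite IH // ltnS leq_subr.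
Qed.

Lemma expcoef_eq w w' n : (forall i, (0 < i <= n)%N -> w i = w' i) ->
  expcoef w n = expcoef w' n.
Proof.
elim/ltn_ind: n => -[|n] IH // ww'.
apply: (@mulfI _ n.+1%:R); first by rewrite pnatr_eq0.
rewrite !expcoefS; apply: eq_bigr => i _; rewrite ww' /= ?ltn_ord //.
rewrite IH // ?ltnS ?leq_subr // => j /andP[j0 jn]; apply: ww'.
by rewrite j0 (leq_trans jn) // (leq_trans (leq_subr _ _)).
Qed.

Lemma expcoef_ge0 w n : (forall i, 0 <= w i) -> 0 <= expcoef w n.
Proof.
move=> w0; elim/ltn_ind: n => -[|n] IH; first by rewrite ler01.
rewrite -(@pmulr_rge0 _ n.+1%:R) ?ltr0Sn // expcoefS.
by apply: sumr_ge0 => i _; rewrite mulr_ge0 ?IH // ltnS leq_subr.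
Qed.

Lemma expcoefZ w y n :
  expcoef (fun i => w i * y ^+ i) n = expcoef w n * y ^+ n.
Proof.
symmetry; move: n; apply: expcoef_unique; first by rewrite mulr1.
move=> n; rewrite mulrA expcoefS mulr_suml; apply: eq_bigr => i _.
rewrite -!mulrA; congr (_ * _); rewrite mulrCA -exprD; congr (_ * _ ^+ _).
by rewrite addSn subnKC // -ltnS.
Qed.

Lemma coefM_eq (p p' r : {poly R}) n : (forall i, (i <= n)%N -> p`_i = p'`_i) ->
  (p * r)`_n = (p' * r)`_n.
Proof.
by move=> pp'; rewrite !coefM; apply: eq_bigr => i _; rewrite pp' // -ltnS.
Qed.

(** The exponential of a sum is a product.  On truncated series this is the
    Leibniz rule for z d/dz, and only coefficients up to n.+1 matter. *)
Lemma expcoefD w w' n :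
  expcoef (fun i => w i + w' i) n =
  \sum_(j < n.+1) expcoef w j * expcoef w' (n - j).
Proof.
symmetry; move: n; apply: expcoef_unique; first by rewrite big_ord1 mulr1.
move=> n.
(* A c truncates the series of c, W c the same series without constant term *)
pose A (c : nat -> R) := \poly_(i < n.+2) c i.
pose W (c : nat -> R) := \poly_(i < n.+2) (c i *+ (0 < i)%N).
have AE (c : nat -> R) i : (i <= n.+1)%N -> (A c)`_i = c i.
  by move=> ni; rewrite coef_poly ltnS ni.
have ME (c d : nat -> R) k : (k <= n.+1)%N ->
    (A c * A d)`_k = \sum_(j < k.+1) c j * d (k - j)%N.
  move=> kn; rewrite coefM; apply: eq_bigr => i _.
  by rewrite !AE // (leq_trans _ kn) ?leq_subr // -ltnS.
have WE (c d : nat -> R) (p : {poly R}) k : (k <= n)%N ->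
    (forall i, (i <= k)%N -> p`_i = d i) ->
    (W c * p)`_k.+1 = \sum_(i < k.+1) c i.+1 * d (k - i)%N.
  move=> kn pd; rewrite coefM big_ord_recl coef_poly mulr0n mul0r add0r.
  apply: eq_bigr => i _; rewrite coef_poly lift0 subSS mulr1n.
  have ik := ltn_ord i; rewrite ltnS in ik.
  by rewrite !ltnS (leq_trans ik kn) pd // leq_subr.
have DE c i : (i <= n.+1)%N ->
    ('X * (A (expcoef c))^`())`_i = (W c * A (expcoef c))`_i.
  case: i => [|i] ni.
    by rewrite coefXM coefM big_ord1 [(W c)`_0]coef_poly ltnn /= mulr0n mul0r.
  rewrite coefXM /= coef_deriv AE // (WE _ (expcoef c)) //; last first.
    by move=> j ji; rewrite AE // (leq_trans ji) // ltnW.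
  by rewrite -expcoefS mulr_natl.
have -> : \sum_(j < n.+2) expcoef w j * expcoef w' (n.+1 - j) =
   (A (expcoef w) * A (expcoef w'))`_n.+1 by rewrite ME.
set P := A (expcoef w); set Q := A (expcoef w').
have -> : n.+1%:R * (P * Q)`_n.+1 = ((W w + W w') * (P * Q))`_n.+1.
  rewrite mulr_natl -coef_deriv -[LHS](coefXM _ n.+1) derivM mulrDr mulrDl.
  rewrite !coefD; congr (_ + _); first by rewrite !mulrA (coefM_eq _ (DE w)).
  by rewrite mulrCA mulrC (coefM_eq _ (DE w')) -mulrA [Q * P]mulrC.
have -> : W w + W w' = W (fun i => w i + w' i).
  by apply/polyP => i; rewrite coefD !coef_poly; case: ifP; rewrite ?addr0 // mulrnDl.
rewrite (WE _ (fun k => \sum_(j < k.+1) expcoef w j * expcoef w' (k - j))) //.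
by move=> i ni; rewrite ME // leqW.
Qed.

End ExpCoef.

(** * The probability that a permutation is smooth *)

Section PermProb.
Variable R : realFieldType.

Definition upto m i : R := (i <= m)%:R.

Lemma sum_upto m n (f : nat -> R) :
  \sum_(i < n) upto m i.+1 * f i = \sum_(i < m | (i < n)%N) f i.
Proof.
have -> : \sum_(i < n) upto m i.+1 * f i = \sum_(i < n | (i < m)%N) f i.
  rewrite [RHS]big_mkcond; apply: eq_bigr => i _; rewrite /upto.
  by case: (i < m)%N; rewrite ?mul1r ?mul0r.
have [mn|/ltnW nm] := leqP m n.
  rewrite [RHS](big_ord_widen_cond n (fun i => i < n)%N f) //.
  by apply: eq_bigl => i; rewrite ltn_ord.
rewrite (big_ord_widen_cond m (fun i => i < m)%N f) //.
by apply: eq_bigl => i; rewrite ltn_ord.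
Qed.

(** The generating function of smooth permutations is
    exp (sum over i <= m of z^i / i).  Summing card_smooth_rec over the words w
    of length i gives a falling factorial, which turns (n - i)! into n!. *)
Lemma card_smooth_on (T : finType) m (S : {set T}) : (0 < m)%N ->
  #|smooth_on m S|%:R = (#|S|)`!%:R * expcoef (upto m) #|S|.
Proof.
move=> m0; move En: #|S| => n; elim/ltn_ind: n S En => -[|n] IH S SE.
  by move/eqP: SE; rewrite cards_eq0 => /eqP->; rewrite smooth_on0 // mulr1.
have /finset.set0Pn[x xS] : S != finset.set0 by rewrite -card_gt0 SE.
rewrite (card_smooth_rec m xS) natr_sum factS natrM.
rewrite [n.+1%:R * _]mulrC -mulrA expcoefS.
have SxE : #|S :\ x| = n by move: SE; rewrite (cardsD1 x) xS => -[].
have step (i : 'I_m) : (\sum_(w : i.-tuple T | all [in S :\ x] w && uniq w)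
     #|smooth_on m (S :\: [set z in x :: w])|)%N%:R
     = (n ^_ i)%:R * ((n - i)`!%:R * expcoef (upto m) (n - i)).
  rewrite natr_sum (eq_bigr (fun=> (n - i)`!%:R * expcoef (upto m) (n - i))).
    rewrite sumr_const [RHS]mulr_natl; congr (_ *+ _).
    have := card_uniq_tuples i [in S :\ x]; rewrite [X in _ = X ^_ _]SxE => <-.
    by rewrite cardsE.
  move=> w /andP[wS uw].
  have xw : x \notin (w : seq T) by apply/negP => /(allP wS) /=; rewrite !inE eqxx.
  have : #|S :\: [set z in x :: w]| = (n - i)%N.
    have sub : [set z in x :: w] \subset S.
      apply/fintype.subsetP => y; rewrite !inE => /predU1P[->//|/(allP wS)] /=.
      by rewrite !inE => /andP[].
    rewrite cardsD (finset.setIidPr sub) SE cardsE.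
    by rewrite (card_uniqP _) /= ?xw // size_tuple subSS.
  by move=> cE; apply: IH cE; rewrite ltnS leq_subr.
rewrite (eq_bigr _ (fun i _ => step i)) {step}.
pose f i := n`!%:R * expcoef (upto m) (n - i).
have -> : \sum_(i < m) (n ^_ i)%:R * ((n - i)`!%:R * expcoef (upto m) (n - i)) =
   \sum_(i < m | (i < n.+1)%N) f i.
  rewrite [RHS]big_mkcond; apply: eq_bigr => i _; rewrite ltnS.
  case: (leqP i n) => [ni|ni]; last by rewrite ffact_small ?mul0r.
  by rewrite /f mulrA -natrM ffact_fact.
by rewrite -sum_upto mulr_sumr; apply: eq_bigr => i _; rewrite /f mulrCA.
Qed.
End PermProb.

(** * Log-concavity *)

Section WindowSums.
(** P is the sequence of probabilities shifted by m, with m zeros in front, so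
    that each n P(n + m) is a full window sum of m consecutive values and no
    boundary case arises. *)
Variables (R : realFieldType) (m' : nat) (P : nat -> R).
Local Notation m := m'.+1.
Hypothesis P0 : forall i, (i < m)%N -> P i = 0.
Hypothesis Pm : P m = 1.
Hypothesis PS : forall n, n%:R * P (n + m)%N = \sum_(i < m) P (n + i)%N.

Lemma window_ge0 i : 0 <= P i.
Proof.
elim/ltn_ind: i => i IH; case: (ltnP i m) => [/P0->//|mi].
move: mi IH => /subnK <-; case: (i - m)%N => [|n] IH; first by rewrite add0n Pm.
rewrite -(@pmulr_rge0 _ n.+1%:R) ?ltr0Sn // PS.
by apply: sumr_ge0 => j _; apply: IH; rewrite ltn_add2l.
Qed.

Lemma window_gt0 n : 0 < P (n + m).
Proof.
elim: n => [|n IH]; first by rewrite Pm.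
rewrite -(@pmulr_rgt0 _ n.+1%:R) ?ltr0Sn // PS big_ord_recr /= addSnnS.
by rewrite ltr_wpDl // sumr_ge0 // => j _; apply: window_ge0.
Qed.

Lemma window_shift n :
  n.+1%:R * P (n.+1 + m)%N = n%:R * P (n + m)%N + P (n + m)%N - P n.
Proof.
rewrite !PS big_ord_recr big_ord_recl /= addn0 addSnnS.
under eq_bigr do rewrite addSnnS.
under [in RHS]eq_bigr do rewrite /bump add1n.
by ring.
Qed.

Lemma window_decr n : P (n.+1 + m) <= P (n + m).
Proof.
rewrite -(@ler_pM2l _ n.+1%:R) ?ltr0Sn // window_shift -[n.+1%:R]natr1.
by rewrite mulrDl mul1r lerBlDr lerDl window_ge0.
Qed.

(** Hansen's argument.  The window sums c_n = n P(n + m) of a log-concave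
    sequence satisfy c_(n+1)^2 - c_n c_(n+2) >= P(n + m) P(n + 1 + m).  The right
    side is at least P(n + 1 + m)^2, and (n + 1)^2 - n (n + 2) = 1, so the
    factors n can be divided out. *)
Lemma window_logconcave_step n :
  (forall i j, (i <= j)%N -> (j <= n + m)%N -> P i * P j.+1 <= P i.+1 * P j) ->
  P (n + m) * P (n.+2 + m) <= P (n.+1 + m) ^+ 2.
Proof.
move=> TP.
case: n TP => [|n] TP.
  have P1 : P (1 + m) = 1.
    have := window_shift 0; rewrite add0n Pm (P0 (ltn0Sn _)).
    by rewrite mul1r mul0r add0r subr0.
  by rewrite add0n Pm mul1r P1 expr1n -[leRHS]P1; apply: window_decr.
move: n TP => n0; move: n0.+1 (ltn0Sn n0) => n {n0} n0 TP.
have s0 := PS n; have s1 := PS n.+1; have s2 := PS n.+2.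
pose Y0 := \sum_(i < m') P (n.+1 + i)%N.
pose Y1 := \sum_(i < m') P (n.+2 + i)%N.
have e0 : n%:R * P (n + m)%N = P n + Y0.
  rewrite s0 big_ord_recl /= addn0; congr (_ + _).
  by apply: eq_bigr => i _; rewrite /bump add1n -addSnnS.
have e1 : n.+1%:R * P (n.+1 + m)%N = Y0 + P (n + m).
  by rewrite s1 big_ord_recr /= -[(n + m)%N]addSnnS.
have e1' : n.+1%:R * P (n.+1 + m)%N = P n.+1 + Y1.
  rewrite s1 big_ord_recl /= addn0; congr (_ + _).
  by apply: eq_bigr => i _; rewrite /bump add1n -addSnnS.
have e2 : n.+2%:R * P (n.+2 + m)%N = Y1 + P (n.+1 + m).
  by rewrite s2 big_ord_recr /= -[(n.+1 + m)%N]addSnnS.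
(* Y0 and Y1 are the overlaps of consecutive windows *)
have cross : P n * Y1 <= P n.+1 * Y0.
  rewrite !mulr_sumr; apply: ler_sum => i _.
  have := ltn_ord i => im; rewrite !addSn; apply: TP; lia.
have rp := window_decr n; have rgt0 := window_gt0 n.+1; have pgt0 := window_gt0 n.
move: e0 e1 e1' e2 cross rp rgt0 pgt0 {s0 s1 s2}.
move: (P n) (P n.+1) (P (n + m)%N) (P (n.+1 + m)%N) (P (n.+2 + m)%N) Y0 Y1.
move=> a b p r t Y0 Y1 e0 e1 e1' e2 cross rp r0 p0.
have N0 : 0 < (n%:R * n.+2%:R : R) by rewrite mulr_gt0 ?ltr0n.
rewrite -subr_ge0 -(pmulr_rge0 _ N0).
have -> : n%:R * n.+2%:R * (r ^+ 2 - p * t) =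
  n%:R * n.+2%:R * r ^+ 2 - (n%:R * p) * (n.+2%:R * t) by ring.
have -> : n%:R * n.+2%:R * r ^+ 2 = (n.+1%:R * r) * (n.+1%:R * r) - r ^+ 2.
  by rewrite -[n.+2%:R]natr1 -[n.+1%:R]natr1; ring.
have key : p * (n.+1%:R * r) - r * (n%:R * p) = p * r.
  by rewrite -[n.+1%:R]natr1; ring.
rewrite e0 e2 {1}e1 e1'; rewrite e1' e0 in key.
have : 0 <= r * (p - r) by rewrite mulr_ge0 ?subr_ge0 // ltW.
move: key cross; nra.
Qed.

(** Log-concavity in the form of decreasing ratios for all pairs i <= j; unlike
    the version with neighbouring indices it says something across the zeros. *)
Lemma window_TP2 i j : (i <= j)%N -> P i * P j.+1 <= P i.+1 * P j.
Proof.
suff H n : forall i j, (i <= j)%N -> (j <= n + m)%N -> P i * P j.+1 <= P i.+1 * P j.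
  by move=> ij; apply: (H j) => //; rewrite leq_addr.
elim: n => [|n IH] {}i {}j ij.
  rewrite add0n => jm; have [im|mi] := ltnP i m.
    by rewrite P0 // mul0r mulr_ge0 // window_ge0.
  have -> : j = m by apply/eqP; rewrite eqn_leq jm (leq_trans mi).
  have -> : i = m by apply/eqP; rewrite eqn_leq mi (leq_trans ij).
  by rewrite mulrC.
rewrite addSn leq_eqVlt ltnS => /predU1P[jE|]; last exact: IH.
move: ij; rewrite jE leq_eqVlt => /predU1P[->|iJ]; first by rewrite mulrC.
have st := window_logconcave_step IH.
rewrite ltnS in iJ; have st2 := IH i (n + m)%N iJ (leqnn _).
rewrite -(ler_pM2l (window_gt0 n)).
have := window_ge0 i; have := window_gt0 n; have := window_gt0 n.+1.
rewrite -?addSn in st st2 * => r0 p0 i0.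
have : P i * (P (n + m) * P (n.+2 + m)) <= P i * P (n.+1 + m) ^+ 2 by rewrite ler_wpM2l.
have : P i * P (n.+1 + m) * P (n.+1 + m) <= P i.+1 * P (n + m) * P (n.+1 + m).
  by rewrite ler_pM2r.
lra.
Qed.

End WindowSums.

(** * Growth of the permutation probabilities *)

Section PermGrowth.
Variables (R : realFieldType) (m' : nat).
Local Notation m := m'.+1.
Local Notation e := (expcoef (upto R m)).
Let P k : R := if (k < m)%N then 0 else e (k - m).

Lemma expcoef_upto_window n : n%:R * P (n + m)%N = \sum_(i < m) P (n + i)%N.
Proof.
case: n => [|n].
  by rewrite mul0r big1 // => i _; rewrite /P add0n ltn_ord.
rewrite {1}/P ltnNge leq_addl /= addnK expcoefS (sum_upto m n.+1 (fun i => e (n - i)%N)) big_mkcond /=.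
rewrite (reindex_inj rev_ord_inj); apply: eq_bigr => i _ /=.
have := ltn_ord i => im; rewrite /P ltnS; case: (leqP (m - i.+1) n) => h.
  rewrite ifF; last by apply/negbTE; lia.
  congr (e _); lia.
by rewrite ifT //; lia.
Qed.

Let PE n : P (n + m) = e n.
Proof. by rewrite /P ltnNge leq_addl /= addnK. Qed.

Let P0 i : (i < m)%N -> P i = 0. Proof. by rewrite /P => ->. Qed.

Lemma expcoef_upto_gt0 n : 0 < e n.
Proof.
rewrite -PE; apply: window_gt0 => //; last exact: expcoef_upto_window.
by rewrite -[m'.+1]add0n PE expcoef0.
Qed.

Lemma expcoef_upto_logconcave i j : (i <= j)%N -> e i * e j.+1 <= e i.+1 * e j.
Proof.
move=> ij; rewrite -!PE !addSn.
apply: (window_TP2 P0 _ expcoef_upto_window); last by rewrite leq_add2r.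
by rewrite -[m'.+1]add0n PE expcoef0.
Qed.

(** The witness is y = e(n-1) / e(n).  Ratios e(k-1) / e(k) increase with k, so
    going down from n costs at most y at each step, and going up from n gains
    at least y at each step; the latter gives y^m <= e(n) / e(n+m), which the
    recurrence bounds by n + m. *)
Lemma expcoef_upto_growth n : (0 < n)%N ->
  exists y : R, [/\ 0 < y, y ^+ m <= (n + m)%:R &
    forall j, (j <= n)%N -> e (n - j) <= y ^+ j * e n].
Proof.
case: n => // n _; exists (e n / e n.+1).
have e0 k := expcoef_upto_gt0 k.
have y0 : 0 < e n / e n.+1 by rewrite divr_gt0.
have lo k : (k <= n)%N -> e k <= e n / e n.+1 * e k.+1.
  move=> kn; rewrite mulrAC ler_pdivlMr // [leRHS]mulrC.
  exact: expcoef_upto_logconcave.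
have hi k : (n <= k)%N -> e n / e n.+1 * e k.+1 <= e k.
  move=> kn; rewrite mulrAC ler_pdivrMr // [leRHS]mulrC.
  exact: expcoef_upto_logconcave.
split=> //; last first.
  elim=> [|j IH] jn; first by rewrite subn0 expr0 mul1r.
  apply: le_trans (lo _ _) _; first lia.
  rewrite -subSn // subSS exprS -[leRHS]mulrA ler_pM2l //; apply: IH; exact: ltnW.
have up j : (e n / e n.+1) ^+ j * e (n.+1 + j)%N <= e n.+1.
  elim: j => [|j IH]; first by rewrite addn0 mul1r.
  apply: le_trans IH; rewrite exprSr -[leLHS]mulrA ler_pM2l ?exprn_gt0 // addnS.
  by apply: hi; rewrite addSn leqW // leq_addr.
rewrite -(@ler_pM2r _ (e (n.+1 + m)%N)) //; apply: le_trans (up m) _.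
rewrite -PE -[e (n.+1 + m)]PE expcoef_upto_window.
rewrite (bigD1 ord0) //= addn0 lerDl sumr_ge0 // => i _.
by rewrite addnAC PE ltW.
Qed.
End PermGrowth.

(** * Monic polynomials and their factorization *)

Section PolyCount.
Variable F : finFieldType.
Local Notation q := #|F|.
Implicit Types (f g P : {poly F}) (n m d k : nat).

(** A sequence over the common type of polynomials, rather than the finite
    types of polynomials of bounded size, so that polynomials of different
    degrees can be multiplied without casts. *)
Definition monics n : seq {poly F} :=
  [seq f <- map val (enum {poly_n.+1 F}) | (f \is monic) && (size f == n.+1)].

Lemma mem_monics n f : (f \in monics n) = (f \is monic) && (size f == n.+1).
Proof.
rewrite mem_filter; apply: andb_idr => /andP[_ /eqP sf].
have sfn : (size f <= n.+1)%N by rewrite sf.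
by apply/mapP; exists (NPoly sfn); rewrite ?mem_enum.
Qed.

Lemma uniq_monics n : uniq (monics n).
Proof. by rewrite filter_uniq // map_inj_uniq ?enum_uniq //; apply: val_inj. Qed.

Lemma card_monic_filter n M (A : pred {poly F}) : (n <= M)%N ->
  #|[pred f : {poly_M.+1 F} |
      [&& (f : {poly F}) \is monic, size f == n.+1 & A f]]| =
  size [seq f <- monics n | A f].
Proof.
move=> nM; rewrite cardE -(size_map val); apply/perm_size/uniq_perm.
- by rewrite map_inj_uniq ?enum_uniq //; apply: val_inj.
- by rewrite filter_uniq ?uniq_monics.
move=> f; rewrite mem_filter mem_monics; apply/mapP/and3P.
  by move=> [g]; rewrite mem_enum inE => /and3P[? ? ?] ->.
move=> [Af mf /eqP sf]; have sfM : (size f <= M.+1)%N by rewrite sf.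
by exists (NPoly sfM); rewrite ?mem_enum ?inE //= mf sf eqxx.
Qed.

Lemma size_monics n : size (monics n) = (q ^ n)%N.
Proof.
have -> : monics n = [seq f <- monics n | predT f] by rewrite filter_predT.
rewrite -card_npoly cardE -(card_monic_filter predT (leqnn n)) cardE.
rewrite -[LHS](size_map val).
rewrite -[RHS](size_map (fun g : {poly_n F} => 'X^n + (g : {poly F}))).
apply/perm_size/uniq_perm.
- by rewrite map_inj_uniq ?enum_uniq //; apply: val_inj.
- by rewrite map_inj_uniq ?enum_uniq // => g h /addrI/val_inj.
move=> f; apply/mapP/mapP => [[g]|[g _ ->]].
  rewrite mem_enum inE => /and3P[mg /eqP sg _] ->.
  have sz : (size (val g - 'X^n)%R <= n)%N.
    apply/leq_sizeP => j nj; rewrite coefB coefXn.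
    move: nj; rewrite leq_eqVlt => /predU1P[<-|nj].
      by move/monicP: mg; rewrite /lead_coef sg /= => ->; rewrite eqxx subrr.
    by rewrite nth_default ?sg // gtn_eqF // subr0.
  by exists (NPoly sz); rewrite ?mem_enum //= addrC subrK.
have sg : (size g < n.+1)%N by rewrite ltnS size_npoly.
have sz : size ('X^n + (g : {poly F})) = n.+1 by rewrite size_polyDl size_polyXn.
have szle : (size ('X^n + (g : {poly F}))%R <= n.+1)%N by rewrite sz.
exists (NPoly szle) => //; rewrite mem_enum inE /= sz eqxx /= andbT.
by rewrite monicE lead_coefDl ?size_polyXn // lead_coefXn.
Qed.

Definition irreds d : seq {poly F} := [seq P <- monics d | irreducibleb P].
Definition nirr d := size (irreds d).

Lemma mem_irreds d P :
  (P \in irreds d) = [&& irreducibleb P, P \is monic & size P == d.+1].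
Proof. by rewrite mem_filter mem_monics. Qed.

Lemma uniq_irreds d : uniq (irreds d).
Proof. exact: filter_uniq (uniq_monics d). Qed.

Lemma irreducible_divisor f : (1 < size f)%N ->
  exists2 P, P \is monic & irreducible_poly P /\ P %| f.
Proof.
have [N] := ubnP (size f); elim: N f => // N IH f fN f1.
have [irf|] := boolP (irreducibleb f).
  have f0 : f != 0 by rewrite -size_poly_gt0 (ltn_trans _ f1).
  have l0 : lead_coef f != 0 by rewrite lead_coef_eq0.
  have l0' : (lead_coef f)^-1 != 0 by rewrite invr_eq0.
  exists ((lead_coef f)^-1 *: f); first by rewrite monicE lead_coefZ mulVf.
  have eqf := eqp_scale f l0'; split; last by rewrite (eqp_dvdl _ eqf).
  move/irreducibleP: irf => [_ irf]; split; first by rewrite size_scale.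
  move=> g g1; rewrite (eqp_dvdr _ eqf) => /(irf _ g1) gf.
  by rewrite (eqp_trans gf) // eqp_sym.
rewrite /irreducibleb f1 /= => /forallPn[g]; rewrite negb_imply -ltnNge.
rewrite -Pdiv.Idomain.dvdpE => /andP[gf g1].
have gs : (size g <= (size f).-1)%N by apply: size_npoly.
have [|P mP [irP Pg]] := IH g _ g1.
  by rewrite (leq_ltn_trans gs) // prednK ?(ltn_trans _ f1).
by exists P => //; split=> //; apply: dvdp_trans gf.
Qed.

(** The multiplicity of P in f, whenever that is at most B. *)
Definition val_upto B P f := (\sum_(k < B) (P ^+ k.+1 %| f)%R)%N.

Lemma irreds_coprime d d' P Q : P \in irreds d -> Q \in irreds d' -> P != Q ->
  coprimep P Q.
Proof.
rewrite !mem_irreds => /and3P[/irreducibleP[P1 iP] mP _] /and3P[/irreducibleP[Q1 iQ] mQ _].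
apply: contraR => nco; rewrite -eqp_monic //.
have g1 : size (gcdp P Q) != 1 by exact: nco.
rewrite -(eqp_ltrans (iP _ g1 (dvdp_gcdl _ _))).
exact: iQ (dvdp_gcdr _ _).
Qed.

Lemma size_irreds d P : P \in irreds d -> size P = d.+1.
Proof. by rewrite mem_irreds => /and3P[_ _ /eqP]. Qed.

Lemma irreds_gt0 d P : P \in irreds d -> (0 < d)%N.
Proof.
by rewrite mem_irreds => /and3P[/irreducibleP[P1 _] _ /eqP sP]; rewrite sP in P1.
Qed.

Lemma irreds_monic d P : P \in irreds d -> P \is monic.
Proof. by rewrite mem_irreds => /and3P[]. Qed.

Lemma monics_mul n n' f g : f \in monics n -> g \in monics n' ->
  f * g \in monics (n + n').
Proof.
rewrite !mem_monics => /andP[mf /eqP sf] /andP[mg /eqP sg].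
by rewrite monicMl // mg size_proper_mul ?sf ?sg ?addnS //= 
  (monicP mf) (monicP mg) mulr1 oner_neq0.
Qed.

Lemma monics_divl n n' f g : f \in monics n -> f * g \in monics (n + n') ->
  g \in monics n'.
Proof.
rewrite !mem_monics => /andP[mf /eqP sf] /andP[mfg /eqP sfg].
have g0 : g != 0.
  by apply: contraTneq mfg => ->; rewrite mulr0 monicE lead_coef0 eq_sym oner_eq0.
move: sfg; rewrite -(monicMl _ mf) mfg size_monicM // sf addSn /= => h.
by rewrite -(eqn_add2l n) h addnS.
Qed.

Lemma monics_exp d k P : P \in monics d -> P ^+ k \in monics (d * k).
Proof.
move=> Pd; elim: k => [|k IH]; first by rewrite muln0 mem_monics monic1 size_poly1.
by rewrite exprS mulnS monics_mul.
Qed.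

Lemma irreds_monics d P : P \in irreds d -> P \in monics d.
Proof. by rewrite mem_filter => /andP[]. Qed.

Lemma val_upto_mul B n d d' P Q g : P \in irreds d -> Q \in irreds d' ->
  g \in monics n -> (n < B)%N ->
  val_upto B Q (P * g) = (val_upto B Q g + (P == Q))%N.
Proof.
move=> Pd Qd gn nB; have [<-|PQ] := eqVneq P Q; last first.
  rewrite addn0; apply: eq_bigr => k _; rewrite Gauss_dvdpr //.
  by rewrite coprimep_expl // (irreds_coprime Qd Pd) // eq_sym.
have P0 : P != 0 by rewrite monic_neq0 // (irreds_monic Pd).
rewrite /val_upto; case: B nB => // B nB.
rewrite big_ord_recl expr1 dvdp_mulIl addn1 big_ord_recr /=.
have -> : (P ^+ B.+1 %| g) = false.
  apply/negbTE/negP => /dvdp_leq.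
  move: gn; rewrite mem_monics => /andP[mg /eqP sg].
  rewrite monic_neq0 // sg => /(_ isT).
  have := monics_exp B.+1 (irreds_monics Pd).
  rewrite mem_monics => /andP[_ /eqP ->].
  have := irreds_gt0 Pd; nia.
rewrite addn0 add1n; congr S; apply: eq_bigr => k _.
by rewrite /bump add1n exprS dvdp_mul2l.
Qed.

(** Unique factorization read through degrees: deg f is the sum over the
    irreducible P of deg P times the multiplicity of P in f. *)
Lemma degree_factorization B n f : (n <= B)%N -> f \in monics n ->
  n = (\sum_(d < B) \sum_(P <- irreds d.+1) d.+1 * val_upto B P f)%N.
Proof.
elim/ltn_ind: n f => n IH f nB fn.
have := fn; rewrite mem_monics => /andP[mf /eqP sf].
case: n => [|n] in IH nB fn sf *.
  have f1 : f = 1.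
    by move: sf => /eqP/size_poly1P[c c0 fc]; move: mf; rewrite fc monicE lead_coefC => /eqP->.
  rewrite big1 // => d _; rewrite big_seq big1 // => P Pd.
  rewrite /val_upto big1 ?muln0 // => k _.
  suff -> : (P ^+ k.+1 %| f) = false by [].
  rewrite f1 dvdp1 (eqP (_ : size (P ^+ k.+1) == (d.+1 * k.+1).+1)) //.
  by have := monics_exp k.+1 (irreds_monics Pd); rewrite mem_monics => /andP[].
have [|P mP [iP Pf]] := @irreducible_divisor f; first by rewrite sf.
pose d := (size P).-1.
have sP : size P = d.+1 by rewrite prednK // (ltn_trans _ iP.1).
have Pd : P \in irreds d by rewrite mem_irreds mP sP eqxx !andbT; apply/irreducibleP.
have d0 := irreds_gt0 Pd.
have dn : (d <= n.+1)%N.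
  have := dvdp_leq (monic_neq0 mf) Pf; rewrite sP sf; lia.
have fE : f = P * (f %/ P) by rewrite mulrC divpK.
move: (f %/ P) fE => g fE.
have gn : g \in monics (n.+1 - d).
  by apply: (monics_divl (irreds_monics Pd)); rewrite -fE subnKC.
have gB : (n.+1 - d < B)%N by lia.
rewrite (eq_bigr (fun e : 'I_B => \sum_(Q <- irreds e.+1) e.+1 * val_upto B Q g
     + \sum_(Q <- irreds e.+1) e.+1 * (P == Q))%N); last first.
  move=> e _; rewrite -big_split /= big_seq [RHS]big_seq; apply: eq_bigr => Q Qe.
  by rewrite fE (val_upto_mul Pd Qe gn gB) mulnDr.
rewrite big_split /= -(IH (n.+1 - d)%N _ g (ltnW gB) gn); last lia.
have dB : (d.-1 < B)%N by lia.
rewrite (bigD1 (Ordinal dB)) //= (prednK d0).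
rewrite (bigD1_seq P) ?uniq_irreds //= eqxx muln1.
rewrite big1 => [|Q /negbTE]; last by rewrite eq_sym => ->; rewrite muln0.
rewrite big1 => [|e ed]; first by rewrite !addn0 subnK.
rewrite big_seq big1 // => Q Qe; case: eqP => [PQ|]; last by rewrite muln0.
case/negP: ed; apply/eqP/val_inj => /=.
by move: (size_irreds Qe); rewrite -PQ sP => -[->].
Qed.

End PolyCount.

(** * Counting smooth polynomials *)

Lemma big_multiples (A : Type) (idx : A) (op : Monoid.com_law idx) d n
    (f : nat -> A) : (0 < d)%N ->
  \big[op/idx]_(k < n %/ d) f (d * k.+1)%N =
  \big[op/idx]_(i < n | (d %| i.+1)%N) f i.+1.
Proof.
move=> d0; elim: n => [|n IH]; first by rewrite div0n !big_ord0.
rewrite [RHS]big_mkcond big_ord_recr -big_mkcond -IH /= divnS // addnC.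
case: ifP => [dn|_]; last by rewrite addn0 Monoid.mulm1.
rewrite addn1 big_ord_recr /=; congr (op _ (f _)).
by rewrite mulnC; have := divnK dn; rewrite divnS // dn add1n.
Qed.

Lemma sum_nat_const_seq (I : Type) (s : seq I) c :
  (\sum_(i <- s) c = size s * c)%N.
Proof. by rewrite big_const_seq count_predT iter_addn_0 mulnC. Qed.

Section SmoothPolyCount.
Variable F : finFieldType.
Local Notation q := #|F|.
Implicit Types (f g P : {poly F}) (n m d k : nat).

Definition smooths m n := [seq f <- monics F n | `[< smooth_poly m f >]].
Definition nsmooth m n := size (smooths m n).

Lemma uniq_smooths m n : uniq (smooths m n).
Proof. exact: filter_uniq (uniq_monics _ _). Qed.

Lemma smooth_poly_mul m d k P f : P \in irreds F d -> (d <= m)%N ->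
  smooth_poly m (P ^+ k * f) <-> smooth_poly m f.
Proof.
move=> Pd dm; split=> sm Q iQ Qf; first by apply: sm => //; rewrite dvdp_mull.
have [Qf'|nQf] := boolP (Q %| f); first exact: sm.
have [lQ|/negbTE] := boolP (coprimep Q P).
  by rewrite Gauss_dvdpr ?coprimep_expr // (negbTE nQf) in Qf.
rewrite /coprimep => /negbT g1; have gP := dvdp_leq _ (dvdp_gcdr Q P).
have P0 : P != 0 by rewrite monic_neq0 // (irreds_monic Pd).
rewrite -(eqp_size (iQ.2 _ g1 (dvdp_gcdl Q P))).
by have := gP P0; rewrite (size_irreds Pd); lia.
Qed.

Lemma size_smooth_multiples m n d k P : P \in irreds F d -> (d <= m)%N ->
  (d * k <= n)%N ->
  size [seq f <- smooths m n | P ^+ k %| f] = nsmooth m (n - d * k).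
Proof.
move=> Pd dm kn; rewrite /nsmooth -[RHS](size_map (fun g => P ^+ k * g)).
have Pk := monics_exp k (irreds_monics Pd).
have Pk0 : P ^+ k != 0 by rewrite expf_neq0 // monic_neq0 // (irreds_monic Pd).
apply/perm_size/uniq_perm.
- exact: filter_uniq (uniq_smooths _ _).
- by rewrite map_inj_uniq ?uniq_smooths //; apply: mulfI.
move=> f; rewrite mem_filter mem_filter; apply/and3P/mapP.
  move=> [/dvdpP[g fE] /asboolP sf fn]; rewrite mulrC in fE.
  exists g => //; rewrite mem_filter; apply/andP; split.
    by apply/asboolP; rewrite -(smooth_poly_mul k _ Pd) // -fE.
  by apply: (monics_divl Pk); rewrite subnKC // -fE.
move=> [g]; rewrite mem_filter => /andP[/asboolP sg gn] ->; split.
- exact: dvdp_mulIl.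
- by apply/asboolP; rewrite (smooth_poly_mul k _ Pd).
- by rewrite -(subnKC kn) monics_mul.
Qed.

(** The von Mangoldt function of F[T] restricted to primes of degree at most m
    and summed over the monic polynomials of degree N. *)
Definition mangoldt m N :=
  (\sum_(d < m | d.+1 %| N) d.+1 * nirr F d.+1)%N.

Lemma sum_nat_cond (s : seq {poly F}) (A : pred {poly F}) :
  (\sum_(f <- s) A f)%N = size [seq f <- s | A f].
Proof. by rewrite -sum1_size big_filter -big_mkcond. Qed.

Lemma sum_val_smooth m n d P : P \in irreds F d ->
  (\sum_(f <- smooths m n) val_upto n P f =
   if d <= m then \sum_(k < n %/ d) nsmooth m (n - d * k.+1) else 0)%N.
Proof.
move=> Pd; have d0 := irreds_gt0 Pd; rewrite exchange_big /=.
case: ifP => dm; last first.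
  rewrite big1 // => k _; rewrite big_seq big1 // => f.
  rewrite mem_filter => /andP[/asboolP sf _].
  case: (boolP (_ %| _)) => // Pf; case/negP: (negbT dm).
  rewrite -[d]/(d.+1.-1) -(size_irreds Pd); apply: sf.
    by move: Pd; rewrite mem_irreds => /and3P[/irreducibleP].
  by apply: dvdp_trans Pf; rewrite dvdp_exp.
rewrite (big_ord_widen n (fun k => nsmooth m (n - d * k.+1))) ?leq_div //.
rewrite [RHS]big_mkcond; apply: eq_bigr => k _.
rewrite leq_divRL // [(k.+1 * d)%N]mulnC; case: ifP => kn.
  by rewrite sum_nat_cond (size_smooth_multiples Pd dm kn).
rewrite big_seq big1 // => f; rewrite mem_filter mem_monics.
case/and3P => _ mf /eqP sf; case: (boolP (_ %| _)) => // /dvdp_leq.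
rewrite monic_neq0 // sf => /(_ isT).
have := monics_exp k.+1 (irreds_monics Pd).
by rewrite mem_monics => /andP[_ /eqP ->]; rewrite ltnS kn.
Qed.

(** Sum degree_factorization over all smooth polynomials of degree n and
    exchange: the smooth multiples of P^k of degree n correspond to the smooth
    polynomials of degree n - k deg P. *)
Lemma nsmooth_rec m n :
  (n * nsmooth m n = \sum_(i < n) mangoldt m i.+1 * nsmooth m (n - i.+1))%N.
Proof.
have -> : (n * nsmooth m n = \sum_(f <- smooths m n) n)%N.
  by rewrite sum_nat_const_seq mulnC.
rewrite big_seq.
rewrite (eq_bigr (fun f =>
    \sum_(d < n) \sum_(P <- irreds F d.+1) d.+1 * val_upto n P f)%N); last first.
  by move=> f; rewrite mem_filter => /andP[_ fn]; apply: degree_factorization.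
rewrite -big_seq exchange_big /=.
have -> : (\sum_(d < n) \sum_(f <- smooths m n) \sum_(P <- irreds F d.+1) d.+1 * val_upto n P f =
  \sum_(d < n | d < m) \sum_(i < n | d.+1 %| i.+1) d.+1 * nirr F d.+1 * nsmooth m (n - i.+1))%N.
  rewrite [RHS]big_mkcond; apply: eq_bigr => d _; rewrite exchange_big /=.
  rewrite -(big_multiples _ n (fun i => d.+1 * nirr F d.+1 * nsmooth m (n - i))%N (ltn0Sn d)).
  rewrite big_seq (eq_bigr (fun P => d.+1 *
    if (d < m)%N then \sum_(k < n %/ d.+1) nsmooth m (n - d.+1 * k.+1) else 0)%N).
    rewrite -big_seq sum_nat_const_seq; case: ifP => _; last by rewrite !muln0.
    by rewrite -big_distrr /= mulnCA mulnA.
  by move=> P Pd; rewrite -big_distrr /= (sum_val_smooth _ _ Pd).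
have -> : (\sum_(d < n | d < m) \sum_(i < n | d.+1 %| i.+1)
      d.+1 * nirr F d.+1 * nsmooth m (n - i.+1) =
   \sum_(d < m | d < n) \sum_(i < n | d.+1 %| i.+1)
      d.+1 * nirr F d.+1 * nsmooth m (n - i.+1))%N.
  set G := fun d => (\sum_(i < n | d.+1 %| i.+1) d.+1 * nirr F d.+1 * nsmooth m (n - i.+1))%N.
  have [mn|/ltnW nm] := leqP m n.
    rewrite [RHS](big_ord_widen_cond n (fun i => i < n)%N G) //.
    by apply: eq_bigl => i; rewrite ltn_ord.
  rewrite (big_ord_widen_cond m (fun i => i < m)%N G) //.
  by apply: eq_bigl => i; rewrite ltn_ord.
rewrite (exchange_big_dep predT) //=; apply: eq_bigr => i _.
rewrite /mangoldt big_distrl /=; apply: eq_bigl => d.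
case: (boolP (d.+1 %| i.+1)%N) => [/dvdn_leq|]; last by rewrite andbF.
by move=> /(_ isT) /leq_trans -> //.
Qed.

Lemma nsmooth_all m n : (n <= m)%N -> nsmooth m n = (q ^ n)%N.
Proof.
move=> nm; rewrite -size_monics /nsmooth /smooths; congr size.
apply/all_filterP/allP => f; rewrite mem_monics => /andP[mf /eqP sf].
apply/asboolP => P _ Pf; have := dvdp_leq (monic_neq0 mf) Pf.
by rewrite sf => h; apply: leq_trans nm; rewrite -subn1 leq_subLR add1n.
Qed.

Lemma nsmooth0 m : nsmooth m 0 = 1%N.
Proof. by rewrite nsmooth_all. Qed.

(** Gauss's formula: in degrees up to m every polynomial is m-smooth, so
    nsmooth_rec becomes n q^n = sum of mangoldt i q^(n-i); subtract q times
    the same identity for n - 1. *)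
Lemma mangoldt_full m N : (0 < N <= m)%N -> mangoldt m N = (q ^ N)%N.
Proof.
case: N => // N /= Nm.
have := nsmooth_rec m N.+1; rewrite big_ord_recr /= subnn nsmooth0 muln1.
have := nsmooth_rec m N; rewrite !nsmooth_all //; last exact: ltnW.
move=> r1; rewrite (eq_bigr (fun i : 'I_N => q * (mangoldt m i.+1 * nsmooth m (N - i.+1))))%N.
  by rewrite -big_distrr /= -r1 expnS mulSn mulnCA addnC => /addnI ->.
move=> i _; rewrite subSn // !nsmooth_all ?expnS; first lia.
  by have := ltn_ord i; lia.
by have := ltn_ord i; lia.
Qed.

Lemma card_field_gt1 : (1 < q)%N.
Proof. by have := card_finNzRing_gt1 F. Qed.

Lemma nirr_le d : (0 < d)%N -> (d * nirr F d <= q ^ d)%N.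
Proof.
case: d => // d _; rewrite -(@mangoldt_full d.+1) ?leqnn // /mangoldt.
by rewrite big_mkcond big_ord_recr /= dvdnn leq_addl.
Qed.

(** By Gauss's formula d pi(d) misses q^d by at most the sum of q^i over
    i <= d/2, which is at most 2 q^(d/2) - 2; and
    2 (2t - 2) <= t^2 for every t. *)
Lemma nirr_ge d : (0 < d)%N -> (q ^ d <= 2 * (d * nirr F d))%N.
Proof.
have q2 := card_field_gt1.
case: d => // d _; have := (@mangoldt_full d.+1 d.+1); rewrite ltn0Sn leqnn /mangoldt.
move/(_ isT); rewrite big_mkcond big_ord_recr /= dvdnn => E.
suff : (2 * \sum_(i < d)
   (if i.+1 %| d.+1 then i.+1 * nirr F i.+1 else 0) <= q ^ d.+1)%N.
  by move: E; move: (\sum_(i < d) _)%N (d.+1 * _)%N (q ^ _)%N => s t u; lia.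
pose K := (d.+1 %/ 2)%N.
have -> : (\sum_(i < d) (if i.+1 %| d.+1 then i.+1 * nirr F i.+1 else 0) =
  \sum_(i < K) (if i.+1 %| d.+1 then i.+1 * nirr F i.+1 else 0))%N.
  rewrite [RHS](big_ord_widen d (fun i => if i.+1 %| d.+1 then i.+1 * nirr F i.+1 else 0)%N).
    rewrite [RHS]big_mkcond; apply: eq_bigr => i _.
    case: ifP => [/dvdnP[c cE]|_]; last by rewrite if_same.
    rewrite ifT // /K leq_divRL // cE.
    have c2 : (1 < c)%N by have := ltn_ord i; case: c cE => [|[|c]] //; lia.
    by rewrite mulnC leq_mul2r c2 orbT.
  rewrite /K; lia.
have sumle k : (\sum_(i < k) (if i.+1 %| d.+1 then i.+1 * nirr F i.+1 else 0) + 2 <= 2 * q ^ k)%N.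
  elim: k => [|k IH]; first by rewrite big_ord0.
  rewrite big_ord_recr /=.
  have : ((if k.+1 %| d.+1 then k.+1 * nirr F k.+1 else 0) <= q ^ k.+1)%N.
    by case: ifP => // _; apply: nirr_le.
  rewrite expnS; move: IH q2.
  move: (\sum_(i < k) _)%N (if _ then _ else _) (q ^ k)%N (q) => s t u p; nia.
have := sumle K.
have : (q ^ K * q ^ K <= q ^ d.+1)%N by rewrite -expnD leq_exp2l // /K; lia.
move: (\sum_(i < K) _)%N (q ^ K)%N (q ^ d.+1)%N => s [|[|t]] u; nia.
Qed.

Variable R : realFieldType.

Definition mangoldt_weight m N : R := (mangoldt m N)%:R / q%:R ^+ N.

(** Dividing by q^n replaces z by z/q in the generating function, so that both
    probabilities have weight 1 in degrees up to m. *)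
Lemma nsmooth_expcoef m n :
  (nsmooth m n)%:R / q%:R ^+ n = expcoef (mangoldt_weight m) n.
Proof.
have q0 k : (q%:R : R) ^+ k != 0.
  by rewrite expf_neq0 // pnatr_eq0 -lt0n (ltn_trans _ card_field_gt1).
move: n; apply: expcoef_unique; first by rewrite nsmooth0 divr1.
move=> n; rewrite mulrA -natrM nsmooth_rec natr_sum mulr_suml.
apply: eq_bigr => i _; rewrite subSS natrM /mangoldt_weight mulrACA -invfM -exprD.
by rewrite addSn subnKC // -ltnS.
Qed.

Lemma mangoldt_weight_upto m N : (0 < N <= m)%N -> mangoldt_weight m N = 1.
Proof.
move=> Nm; rewrite /mangoldt_weight mangoldt_full // natrX divff //.
by rewrite expf_neq0 // pnatr_eq0 -lt0n (ltn_trans _ card_field_gt1).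
Qed.

Lemma mangoldt_weight_ge0 m N : 0 <= mangoldt_weight m N.
Proof. by rewrite divr_ge0 ?exprn_ge0 ?ler0n. Qed.

End SmoothPolyCount.

(** * Partial sums of the logarithm and of the exponential *)

Section LogTail.
Variable R : realType.

(** All the comparisons below are between the logarithm of a polynomial and a
    polynomial, so one application of the mean value theorem serves for all. *)
Lemma ln_horner_mvt (P Q : {poly R}) (w : R) : 0 <= w ->
  (forall t, 0 <= t <= w -> 0 < P.[t]) ->
  exists2 c, 0 <= c <= w &
    (ln P.[w] - Q.[w]) - (ln P.[0] - Q.[0]) =
    ((P.[c])^-1 * P^`().[c] - Q^`().[c]) * w.
Proof.
move=> w0 Ppos.
pose f : R -> R := ((@ln R) \o horner P) - horner Q.
pose df t := (P.[t])^-1 * P^`().[t] - Q^`().[t].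
have fd t : t \in `[0, w]%R -> is_derive t (1 : R) f (df t).
  rewrite in_itv /= => /Ppos Pt; rewrite /f /df.
  apply: is_deriveB; apply: is_derive1_comp; exact: is_derive1_ln.
have fc : ({within `[0%R, w], continuous f})%classic.
  apply: derivable_within_continuous => t tw; have [] := fd t tw.
  by [].
have fo t : t \in `]0, w[%R -> is_derive t (1 : R) f (df t).
  by move=> tw; apply: fd; apply: subset_itv_oo_cc.
have [c] := MVT_segment w0 fo fc.
by rewrite in_itv /= subr0 => cw cE; exists c.
Qed.

(** The partial sum of -log (1 - t); the inverse of 0 is 0, so there is no
    constant term. *)
Definition logsum K : {poly R} := \poly_(i < K.+1) (i%:R)^-1.

Lemma horner_logsum K t : (logsum K).[t] = \sum_(k < K) t ^+ k.+1 / k.+1%:R.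
Proof.
rewrite horner_poly big_ord_recl invr0 mul0r add0r.
by apply: eq_bigr => i _; rewrite lift0 mulrC.
Qed.

Lemma logsum0 K : (logsum K).[0] = 0.
Proof. by rewrite horner_logsum big1 // => i _; rewrite expr0n mul0r. Qed.

Lemma deriv_logsum K t : (1 - t) * (logsum K)^`().[t] = 1 - t ^+ K.
Proof.
have -> : (logsum K)^`() = \sum_(i < K) 'X^i.
  apply/polyP => i; rewrite coef_deriv coef_poly ltnS coef_sum.
  under eq_bigr do rewrite coefXn.
  case: ltnP => iK; last first.
    rewrite mul0rn big1 // => j _; have := ltn_ord j => jK.
    by rewrite gtn_eqF ?(leq_trans jK iK).
  rewrite (bigD1 (Ordinal iK)) //= eqxx big1 ?addr0.
    by rewrite -[LHS]mulr_natr mulVf ?pnatr_eq0.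
  by move=> j /eqP ne; case: eqP => // e; case: ne; apply/val_inj/esym.
rewrite horner_sum; under eq_bigr do rewrite hornerXn.
rewrite -[RHS]opprB -[1 - t]opprB mulNr; congr (- _).
by rewrite [RHS]subrX1.
Qed.

Lemma logsum_le K (w : R) : 0 <= w < 1 ->
  \sum_(k < K) w ^+ k.+1 / k.+1%:R <= - ln (1 - w).
Proof.
move=> /andP[w0 w1].
have [|c /andP[c0 cw]] := @ln_horner_mvt (1 - 'X) (- logsum K) w w0.
  by move=> t /andP[_ tw]; rewrite !hornerE; lra.
rewrite derivB derivX derivN !hornerE logsum0 horner_logsum.
rewrite ?derivC ?horner0 ?subr0 ln1 ?oppr0 ?subr0.
have c1 : 0 < 1 - c by lra.
have := deriv_logsum K c; move: (_^`().[c]) => D DE.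
have -> : (1 - c)^-1 * (0 - 1) - - D = - ((1 - c)^-1 * c ^+ K).
  have -> : c ^+ K = 1 - (1 - c) * D by rewrite DE; ring.
  by field; rewrite gt_eqF.
have : 0 <= (1 - c)^-1 * c ^+ K * w.
  by rewrite !mulr_ge0 ?invr_ge0 ?exprn_ge0 // ltW.
lra.
Qed.

Lemma logsum_ge K (w : R) : 0 <= w < 1 ->
  - ln (1 - w) <= \sum_(k < K) w ^+ k.+1 / k.+1%:R
     + w ^+ K.+1 / (K.+1%:R * (1 - w)).
Proof.
move=> /andP[w0 w1].
pose a := (K.+1%:R * (1 - w))^-1.
have [|c /andP[c0 cw]] := @ln_horner_mvt (1 - 'X) (- (logsum K + a *: 'X^(K.+1))) w w0.
  by move=> t /andP[_ tw]; rewrite !hornerE; lra.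
rewrite derivB derivX derivN derivD derivZ derivXn !hornerE logsum0 horner_logsum.
rewrite ?derivC ?horner0 ?subr0 ln1 expr0n mulr0 !addr0 ?oppr0 ?subr0.
have c1 : 0 < 1 - c by lra.
have w1' : 0 < 1 - w by lra.
rewrite hornerMn hornerXn -mulr_natl.
have := deriv_logsum K c; move: (_^`().[c]) => D DE.
have -> : (1 - c)^-1 * (0 - 1) - - (D + a * (K.+1%:R * c ^+ K)) =
    c ^+ K * ((1 - w)^-1 - (1 - c)^-1).
  have -> : c ^+ K = 1 - (1 - c) * D by rewrite DE; ring.
  rewrite /a; field.
  by rewrite !gt_eqF.
have : 0 <= c ^+ K * ((1 - w)^-1 - (1 - c)^-1) * w.
  rewrite !mulr_ge0 ?exprn_ge0 // subr_ge0 lef_pV2 ?posrE //; lra.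
rewrite -[w ^+ K.+1 / _]mulrC -/a; lra.
Qed.

(** The coefficients of exp B sum to at most exp (B 1) when B >= 0, even for a
    truncated B.  With S the polynomial of the first coefficients, truncation
    only makes S' smaller than B' S, so log S - B decreases on [0, 1] from 0. *)
Lemma exp_partial_sum (h b : nat -> R) n : h 0%N = 1 -> (forall i, 0 <= h i) ->
  (forall i, 0 <= b i) ->
  (forall k, k.+1%:R * h k.+1 = \sum_(i < k.+1) b i.+1 * h (k - i)%N) ->
  \sum_(j < n.+1) h j <= expR (\sum_(i < n) b i.+1 / i.+1%:R).
Proof.
move=> h0 hge bge hS.
pose S := \poly_(i < n.+1) h i.
pose B := \poly_(i < n.+1) (b i * (i%:R)^-1).
have SE t : S.[t] = 1 + \sum_(i < n) h i.+1 * t ^+ i.+1.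
  by rewrite horner_poly big_ord_recl h0 expr0 mulr1.
have Spos t : 0 <= t <= 1 -> 0 < S.[t].
  move=> /andP[t0 _]; rewrite SE ltr_wpDr // sumr_ge0 // => i _.
  by rewrite mulr_ge0 ?exprn_ge0.
have [c /andP[c0 c1]] := ln_horner_mvt B ler01 Spos.
have S0 : S.[0] = 1.
  by rewrite SE big1 ?addr0 // => i _; rewrite expr0n mulr0.
have B0 : B.[0] = 0.
  rewrite horner_poly big1 // => -[[|i] ?] _ /=; first by rewrite invr0 mulr0 mul0r.
  by rewrite expr0n mulr0.
rewrite S0 B0 ln1 subr0 subr0 mulr1 => cE.
have Sc := Spos c; rewrite c0 c1 in Sc; move/(_ isT): Sc => Sc.
have dle : S^`().[c] <= B^`().[c] * S.[c].
  rewrite -hornerM.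
  have dS : S^`() = \poly_(i < n) (i.+1%:R * h i.+1).
    apply/polyP => i; rewrite coef_deriv !coef_poly ltnS.
    by case: ifP => _; rewrite ?mul0rn // mulr_natl.
  have dB : B^`() = \poly_(i < n) b i.+1.
    apply/polyP => i; rewrite coef_deriv !coef_poly ltnS.
    case: ifP => _; rewrite ?mul0rn //.
    by rewrite -[LHS]mulr_natr divfK // pnatr_eq0.
  have coefS i : 0 <= S`_i by rewrite coef_poly; case: ifP.
  have coefB i : 0 <= (B^`())`_i by rewrite dB coef_poly; case: ifP.
  have coefBS i : 0 <= (B^`() * S)`_i.
    by rewrite coefM sumr_ge0 // => j _; rewrite mulr_ge0.
  have [N nN BN] : exists2 N, (n <= N)%N & (size (B^`() * S)%R <= N)%N.
    by exists (maxn n (size (B^`() * S)%R)); rewrite ?leq_maxl ?leq_maxr.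
  rewrite [leRHS](horner_coef_wide _ BN).
  rewrite dS (@horner_coef_wide _ N); last first.
    by rewrite (leq_trans (size_poly _ _)).
  apply: ler_sum => i _; rewrite ler_wpM2r ?exprn_ge0 //.
  rewrite coef_poly; case: ltnP => // ni.
  rewrite hS coefM dB; apply: ler_sum => j _.
  have ji := ltn_ord j; rewrite ltnS in ji.
  rewrite !coef_poly (leq_ltn_trans ji ni) ltnS.
  by rewrite (leq_trans (leq_subr _ _)) // ltnW.
have S1 : 0 < S.[1] by apply: Spos; rewrite ler01 lexx.
have -> : \sum_(j < n.+1) h j = S.[1].
  by rewrite horner_poly; apply: eq_bigr => i _; rewrite expr1n mulr1.
have -> : \sum_(i < n) b i.+1 / i.+1%:R = B.[1].
  rewrite horner_poly big_ord_recl invr0 mulr0 mul0r add0r.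
  by apply: eq_bigr => i _; rewrite lift0 expr1n mulr1.
rewrite -[S.[1]]lnK ?posrE // ler_expR -subr_le0 cE subr_le0.
by rewrite mulrC ler_pdivrMr.
Qed.

End LogTail.

(** * The logarithm of G_q *)

Section LogG.
Variables (R : realType) (F : finFieldType).
Local Notation q := (#|F|%:R : R).

Lemma q_ge2 : 2 <= q.
Proof. by rewrite (ler_nat _ 2) card_field_gt1. Qed.

Lemma q_gt0 : 0 < q. Proof. by have := q_ge2; lra. Qed.

Lemma cancel_frac (a x y : R) : a != 0 -> (a * x) / (a * y) = x / y.
Proof. by move=> a0; rewrite invfM mulrACA divff // mul1r. Qed.

Lemma prod_irreducible m (h : nat -> R) :
  \prod_(P : {poly_m.+1 F} | ((P : {poly F}) \is monic) && irreducibleb P)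
     h (size P).-1 = \prod_(d < m) h d.+1 ^+ nirr F d.+1.
Proof.
pose A (P : {poly_m.+1 F}) := ((P : {poly F}) \is monic) && irreducibleb P.
transitivity (\prod_(P | A P) \prod_(d < m | d.+1 == (size P).-1) h d.+1).
  apply: eq_bigr => P /andP[_ /irreducibleP[sP _]].
  have sPm : ((size P).-2 < m)%N.
    by move: sP (size_npoly P) => /=; case: (size _) => [|[|s]].
  rewrite (big_pred1 (Ordinal sPm)) /=; last first.
    by move=> d; rewrite /= -val_eqE /=; move: sP; case: (size _) => [|[|s]].
  by congr h; move: sP; case: (size _) => [|[|s]].
rewrite (exchange_big_dep predT) //=; apply: eq_bigr => d _.
rewrite prodr_const; congr (_ ^+ _).
rewrite /nirr /irreds -(@card_monic_filter F d.+1 m) //.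
apply: eq_card => P; rewrite /A !unfold_in /= -andbA; congr (_ && _).
case: (boolP (irreducibleb P)) => [/irreducibleP[sP _]|_]; last by rewrite andbF.
by rewrite andbT /=; move: sP; case: (size _) => [|[|s]] //= _; rewrite eq_sym.
Qed.

Definition logtail K (w : R) := - ln (1 - w) - \sum_(k < K) w ^+ k.+1 / k.+1%:R.

(** The logarithm of G_q(z) as a sum over degrees; m %/ d.+1 is the number of
    powers of u^(d.+1) of exponent at most m, which the exponential factor of
    G_q cancels. *)
Definition logG m z : R :=
  \sum_(d < m) (nirr F d.+1)%:R * logtail (m %/ d.+1) ((z / q) ^+ d.+1).

Lemma sum_mangoldt m n (u : R) :
  \sum_(i < n) (mangoldt F m i.+1)%:R * u ^+ i.+1 / i.+1%:R =
  \sum_(d < m) (nirr F d.+1)%:R *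
     \sum_(k < n %/ d.+1) (u ^+ d.+1) ^+ k.+1 / k.+1%:R.
Proof.
rewrite [RHS](eq_bigr (fun d : 'I_m => \sum_(i < n | (d.+1 %| i.+1)%N)
    (d.+1 * nirr F d.+1)%:R * u ^+ i.+1 / i.+1%:R)); last first.
  move=> d _; rewrite -(big_multiples _ n (fun i => (d.+1 * nirr F d.+1)%:R * u ^+ i / i%:R) (ltn0Sn d)).
  rewrite mulr_sumr; apply: eq_bigr => k _; rewrite -exprM !natrM.
  by rewrite -[_ * _ * _ ^+ _]mulrA cancel_frac ?pnatr_eq0 // mulrA.
rewrite (exchange_big_dep predT) //=; apply: eq_bigr => i _.
by rewrite natr_sum !mulr_suml.
Qed.

Lemma expr_u_bounds (z : R) d : 0 < z < q -> 0 < (z / q) ^+ d.+1 < 1.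
Proof.
move=> /andP[z0 zq]; have q0 := q_gt0.
have u0 : 0 < z / q by rewrite divr_gt0.
by rewrite exprn_gt0 // exprn_ilt1 ?ltW // ltr_pdivrMr // mul1r.
Qed.

Lemma logsum_mangoldt m n (z : R) : (n <= m)%N ->
  \sum_(i < n) z ^+ i.+1 / i.+1%:R =
  \sum_(i < n) (mangoldt F m i.+1)%:R * (z / q) ^+ i.+1 / i.+1%:R.
Proof.
move=> nm; apply: eq_bigr => i _; have q0 := q_gt0.
rewrite mangoldt_full ?(leq_trans _ nm) // natrX expr_div_n mulrCA divff ?mulr1 //.
by rewrite expf_neq0 // gt_eqF.
Qed.

Lemma Gq_expR m (z : R) : 0 < z < q -> Gq F m z = expR (logG m z).
Proof.
move=> zq; rewrite /Gq (prod_irreducible m (fun d => (1 - (z / q) ^+ d)^-1)).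
have -> : \prod_(d < m) (1 - (z / q) ^+ d.+1)^-1 ^+ nirr F d.+1 =
  expR (\sum_(d < m) (nirr F d.+1)%:R * (- ln (1 - (z / q) ^+ d.+1))).
  rewrite expR_sum; apply: eq_bigr => d _; rewrite expRM_natl expRN lnK //.
  by rewrite posrE subr_gt0; have /andP[_ ->] := expr_u_bounds d zq.
rewrite -expRD; congr expR.
rewrite big_add1 big_mkord (logsum_mangoldt _ (leqnn m)) sum_mangoldt -sumrB.
by apply: eq_bigr => d _; rewrite -mulrBr.
Qed.

Lemma logtail_le K (w : R) : 0 <= w < 1 ->
  logtail K w <= w ^+ K.+1 / (K.+1%:R * (1 - w)).
Proof. by move=> w01; rewrite /logtail lerBlDl logsum_ge. Qed.

Lemma logtail_ge K (w : R) : 0 <= w < 1 -> w ^+ K.+1 / K.+1%:R <= logtail K w.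
Proof.
move=> w01; rewrite /logtail; have := logsum_le K.+1 w01.
by rewrite big_ord_recr /= lerBrDl.
Qed.

Lemma logtail_ge0 K (w : R) : 0 <= w < 1 -> 0 <= logtail K w.
Proof. by move=> w01; rewrite /logtail subr_ge0 logsum_le. Qed.

Lemma logG_term_ge0 m (z : R) d : 0 < z < q ->
  0 <= (nirr F d.+1)%:R * logtail (m %/ d.+1) ((z / q) ^+ d.+1).
Proof.
move=> zq; rewrite mulr_ge0 // logtail_ge0 //.
by have /andP[/ltW -> ->] := expr_u_bounds d zq.
Qed.

Lemma logG_ge0 m (z : R) : 0 < z < q -> 0 <= logG m z.
Proof. by move=> zq; apply: sumr_ge0 => d _; apply: logG_term_ge0. Qed.

(** N stands for the least multiple of d beyond m.  The tail in degree d is at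
    most u^N / (N/d) / (1 - u), and pi(d) <= q^d / d, so each degree contributes
    at most E / (N (1 - u)) with N > m; there are m degrees. *)
Lemma logG_le_of m (z E : R) : (0 < m)%N -> 0 < z < q ->
  (forall d N, (0 < d <= m)%N -> (m < N)%N -> (d.*2 <= N)%N ->
      q ^+ d * (z / q) ^+ N <= E) ->
  logG m z <= E / (1 - z / q).
Proof.
move=> m0 zq HE; have q0 := q_gt0.
have /andP[u0 u1] := expr_u_bounds 0 zq; rewrite expr1 in u0 u1.
set u := z / q in u0 u1 HE *.
have E0 : 0 <= E.
  apply: le_trans (HE 1%N m.+2 _ _ _) => //; try lia.
  by rewrite mulr_ge0 ?exprn_ge0 // ltW.
have term d : (d < m)%N -> (nirr F d.+1)%:R * logtail (m %/ d.+1) (u ^+ d.+1)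
   <= E / (m%:R * (1 - u)).
  move=> dm; have /andP[w0 w1] := expr_u_bounds d zq; rewrite -/u in w0 w1.
  set K := (m %/ d.+1)%N; set w := u ^+ d.+1 in w0 w1 *.
  have w01 : 0 <= w < 1 by rewrite ltW.
  have K0 : (0 < K)%N by rewrite divn_gt0.
  have mN : (m < d.+1 * K.+1)%N by rewrite mulnC ltn_ceil.
  have dN : (d.+1.*2 <= d.+1 * K.+1)%N by rewrite -muln2 leq_mul2l ltnS K0 orbT.
  have := HE d.+1 (d.+1 * K.+1)%N; rewrite dm mN dN exprM -/w => /(_ isT isT isT) HN.
  have wu : w <= u by rewrite /w exprS ler_piMr ?exprn_ile1 ?ltW // ltW.
  have nq : d.+1%:R * (nirr F d.+1)%:R <= q ^+ d.+1.
    by rewrite -natrM -natrX ler_nat nirr_le.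
  apply: le_trans (_ : (nirr F d.+1)%:R * (w ^+ K.+1 / (K.+1%:R * (1 - w))) <= _).
    by rewrite ler_wpM2l ?ler0n // logtail_le.
  have -> : (nirr F d.+1)%:R * (w ^+ K.+1 / (K.+1%:R * (1 - w))) =
    (d.+1%:R * (nirr F d.+1)%:R * w ^+ K.+1) / ((d.+1 * K.+1)%:R * (1 - w)).
    rewrite natrM -[d.+1%:R * _ * w ^+ _]mulrA -[d.+1%:R * _ * (1 - w)]mulrA.
    by rewrite cancel_frac ?pnatr_eq0 // mulrA.
  apply: ler_pM.
  - by rewrite !mulr_ge0 ?exprn_ge0 // ltW.
  - by rewrite invr_ge0 mulr_ge0 // subr_ge0 ltW.
  - by apply: le_trans HN; rewrite ler_wpM2r // exprn_ge0 // ltW.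
  - rewrite lef_pV2 ?posrE ?mulr_gt0 ?ltr0n ?subr_gt0 //.
    by apply: ler_pM; rewrite ?ler0n ?subr_ge0 ?ler_nat ?(ltnW mN) ?(ltW u1) ?lerB //.
apply: le_trans (_ : \sum_(d < m) E / (m%:R * (1 - u)) <= _).
  by apply: ler_sum => d _; apply: term.
rewrite sumr_const card_ord -[leLHS]mulr_natl.
rewrite (_ : _ * _ = E / (1 - u)) //; field.
by rewrite pnatr_eq0 -lt0n m0 subr_eq0 gt_eqF.
Qed.

(** q^d u^N = (q u^2)^d u^(N - 2d) and q u^2 = z^2 / q.  If this is at least 1
    the worst case is d = m, N = 2m.  If it is at most 1, then q^d u^N is at most
    (q u^2)^(N/2) with N > m, whence the square root of (z^2 / q)^m. *)
Lemma logG_le m (z E : R) : (0 < m)%N -> 0 < z < q -> 0 <= E ->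
  (z ^+ 2 <= q /\ (z ^+ 2 / q) ^+ m <= E ^+ 2) \/
  (q <= z ^+ 2 /\ (z ^+ 2 / q) ^+ m <= E) ->
  logG m z <= E / (1 - z / q).
Proof.
move=> m0 zq E0 H; apply: logG_le_of => // d N /andP[d0 dm] mN dN.
have /andP[z0 _] := zq; have q0 := q_gt0.
have u0 : 0 < z / q by rewrite divr_gt0.
have r0 : 0 < z ^+ 2 / q by rewrite divr_gt0 ?exprn_gt0.
have qu : z ^+ 2 / q = q * (z / q) ^+ 2 by field; rewrite gt_eqF.
case: H => -[zle HE].
  have r1 : z ^+ 2 / q <= 1 by rewrite ler_pdivrMr ?mul1r.
  rewrite -(@ler_pXn2r _ 2) ?nnegrE ?mulr_ge0 ?exprn_ge0 ?(ltW u0) ?(ltW q0) //.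
  apply: le_trans HE; apply: le_trans (_ : (z ^+ 2 / q) ^+ N <= _); last first.
    by apply: ler_wiXn2l; rewrite ?(ltW r0) ?(ltnW mN) //.
  rewrite qu; move: (z / q) u0 => u u0; rewrite [leLHS]exprMn [leRHS]exprMn -!exprM (mulnC N 2%N).
  rewrite ler_wpM2r ?exprn_ge0 ?(ltW u0) // ler_weXn2l ?(le_trans _ q_ge2) ?ler1n //.
  by rewrite muln2.
have r1 : 1 <= z ^+ 2 / q by rewrite ler_pdivlMr ?mul1r.
apply: le_trans HE; apply: le_trans (_ : (z ^+ 2 / q) ^+ d <= _); last first.
  exact: ler_weXn2l.
rewrite qu [leRHS]exprMn -exprM ler_pM2l ?exprn_gt0 //.
apply: ler_wiXn2l; rewrite ?(ltW u0) ?mul2n //.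
by have /andP[_ /ltW] := expr_u_bounds 0 zq.
Qed.

(** For m/2 < d <= m the tail starts with u^(2d) / 2. *)
Lemma logG_term_ge m (z : R) d : 0 < z < q -> (d < m)%N -> (m < d.+1.*2)%N ->
  (z ^+ 2 / q) ^+ d.+1 / (4 * d.+1%:R) <=
  (nirr F d.+1)%:R * logtail (m %/ d.+1) ((z / q) ^+ d.+1).
Proof.
move=> zq dm md; have /andP[w0 w1] := expr_u_bounds d zq; have q0 := q_gt0.
have -> : (m %/ d.+1 = 1)%N.
  apply/eqP; rewrite eqn_leq divn_gt0 // dm andbT -ltnS ltn_divLR //.
  by rewrite mul2n.
have w01 : 0 <= (z / q) ^+ d.+1 < 1 by rewrite ltW.
apply: le_trans (_ : (nirr F d.+1)%:R * (((z / q) ^+ d.+1) ^+ 2 / 2) <= _); last first.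
  by rewrite ler_wpM2l ?ler0n // logtail_ge.
have nq : q ^+ d.+1 <= 2 * (d.+1%:R * (nirr F d.+1)%:R).
  by rewrite -natrM -(natrM _ 2) -natrX ler_nat nirr_ge.
have -> : z ^+ 2 / q = q * (z / q) ^+ 2 by field; rewrite gt_eqF.
rewrite [(q * _) ^+ _]exprMn -!exprM (mulnC 2%N) ler_pdivrMr ?mulr_gt0 ?ltr0n //.
have X0 : 0 <= (z / q) ^+ (d.+1 * 2).
  by rewrite exprM exprn_ge0 // ltW.
apply: le_trans (_ : 2 * (d.+1%:R * (nirr F d.+1)%:R) * (z / q) ^+ (d.+1 * 2) <= _).
  by rewrite ler_wpM2r.
by rewrite le_eqVlt; apply/orP; left; apply/eqP; field.
Qed.

Lemma logG_ge_last m (z : R) : (0 < m)%N -> 0 < z < q ->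
  (z ^+ 2 / q) ^+ m / (4 * m%:R) <= logG m z.
Proof.
case: m => // m _ zq; rewrite /logG big_ord_recr /=.
apply: le_trans (logG_term_ge zq (ltnSn m) _) _.
  by rewrite -addnn addSn ltnS leq_addl.
by rewrite lerDr; apply: sumr_ge0 => d _; apply: logG_term_ge0.
Qed.

(** At least m/2 degrees d exceed m/2, and each contributes at least
    kap / (4m). *)
Lemma logG_ge_half m (z kap : R) : (0 < m)%N -> 0 < z < q -> 0 <= kap <= 1 ->
  kap <= (z ^+ 2 / q) ^+ m -> kap / 8 <= logG m z.
Proof.
move=> m0 zq /andP[k0 k1] kz; have /andP[z0 _] := zq; have q0 := q_gt0.
have r0 : 0 < z ^+ 2 / q by rewrite divr_gt0 ?exprn_gt0.
rewrite /logG (bigID (fun d : 'I_m => (m./2 <= d)%N)) /=.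
apply: le_trans (_ : \sum_(d < m | (m./2 <= d)%N) kap / (4 * m%:R) <= _); last first.
  rewrite -[leLHS]addr0; apply: lerD; last first.
    by apply: sumr_ge0 => d _; apply: logG_term_ge0.
  apply: ler_sum => d md; have dm := ltn_ord d.
  apply: le_trans (logG_term_ge zq dm _); last first.
    by rewrite -ltn_half_double in md *; lia.
  apply: ler_pM => //.
  - have [r1|r1] := leP 1 (z ^+ 2 / q).
      by rewrite (le_trans k1) // exprn_ege1.
    by apply: le_trans kz _; apply: ler_wiXn2l; rewrite ?(ltW r0) ?(ltW r1).
  - by rewrite lef_pV2 ?posrE ?mulr_gt0 ?ltr0n // ler_pM2l // ler_nat.
rewrite sumr_const.
have -> : #|[pred d : 'I_m | (m./2 <= d)%N]| = (m - m./2)%N.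
  rewrite -sum1_card /= -(big_mkord (fun d => (m./2 <= d)%N) (fun=> 1%N)).
  rewrite (big_cat_nat _ (n := m./2)) //=; last by lia.
  rewrite big_nat_cond big_pred0 ?add0n; last by move=> i; lia.
  rewrite big_nat_cond (eq_bigl (fun i => (m./2 <= i < m)%N)) -?big_nat; last by move=> i; lia.
  by rewrite sum_nat_const_nat muln1.
rewrite -[leRHS]mulr_natr mulrAC ler_pdivlMr ?mulr_gt0 ?ltr0n //.
have -> : kap / 8 * (4 * m%:R) = kap * (m%:R / 2) by field.
rewrite ler_wpM2l // ler_pdivrMr // -natrM ler_nat; lia.
Qed.

End LogG.

(** * Comparison of the two probabilities *)

Section Ratio.
Variables (R : realType).

Lemma prob_perm_smoothE n m : (0 < m)%N ->
  prob_perm_smooth R n m = expcoef (upto R m) n.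
Proof.
move=> m0; rewrite /prob_perm_smooth /unif_prob.
have -> : #|(predT : {pred 'S_n})| = n`!%N by rewrite -card_Sn; apply: eq_card.
have -> : #|[predI predT & @smooth_perm m n]| = #|smooth_on m (finset.setTfor 'I_n)|.
  apply: eq_card => s; rewrite [RHS]inE !inE /=.
  have -> /= : perm_on finset.setT s by apply/fintype.subsetP => x _; rewrite inE.
  apply/forall_inP/forallP => [H x|H C /imsetP[x _ ->]]; last exact: H.
  by apply: H; apply: imset_f.
have := @card_smooth_on R _ m (finset.setTfor 'I_n) m0.
rewrite cardsT card_ord => ->.
by rewrite mulrC mulKf // pnatr_eq0 -lt0n fact_gt0.
Qed.

Variable (F : finFieldType).
Local Notation q := (#|F|%:R : R).

Lemma prob_poly_smoothE n m :
  prob_poly_smooth R F n m = expcoef (mangoldt_weight F R m) n.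
Proof.
rewrite -nsmooth_expcoef /prob_poly_smooth /unif_prob; congr (_%:R / _).
  rewrite /nsmooth /smooths -(@card_monic_filter F n n) //.
  by apply: eq_card => f; rewrite !unfold_in /= -andbA.
rewrite -natrX -size_monics -[monics F n]filter_predT -(@card_monic_filter F n n) //.
by congr (_%:R); apply: eq_card => f; rewrite !unfold_in /= andbT.
Qed.

Lemma smooth_ratio_ge1 n m : (0 < m)%N ->
  1 <= prob_poly_smooth R F n m / prob_perm_smooth R n m.
Proof.
move=> m0; rewrite prob_perm_smoothE // prob_poly_smoothE.
have e0 k : 0 < expcoef (upto R m) k.
  by case: m m0 => // m' _; apply: expcoef_upto_gt0.
rewrite ler_pdivlMr // mul1r.
elim/ltn_ind: n => -[|n] IH; first by rewrite !expcoef0.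
rewrite -(@ler_pM2l _ n.+1%:R) ?ltr0Sn // !expcoefS.
apply: ler_sum => i _; apply: ler_pM; rewrite ?ler0n ?(ltW (e0 _)) //.
  rewrite /upto; case: leqP => im /=; first by rewrite ?mulr0n mangoldt_weight_ge0.
  by rewrite mangoldt_weight_upto.
by apply: IH; rewrite ltnS leq_subr.
Qed.

(** The weights of the two recurrences differ only beyond m, so v is the
    convolution of p with the coefficients g of G_q; then v(n) is at most p(n)
    times the sum of g_j y^j over j <= n, a partial sum of G_q(y). *)
Lemma smooth_ratio_le_Gq n m : (0 < m <= n)%N ->
  exists y : R, [/\ 0 < y, y ^+ m <= (n + m)%:R &
    y < q -> prob_poly_smooth R F n m / prob_perm_smooth R n m <= Gq F m y].
Proof.
move=> /andP[m0 mn]; rewrite prob_perm_smoothE // prob_poly_smoothE.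
have e0 k : 0 < expcoef (upto R m) k.
  by case: m m0 {mn} => // m' _; apply: expcoef_upto_gt0.
have [y [y0 ym ye]] : exists y : R, [/\ 0 < y, y ^+ m <= (n + m)%:R &
    forall j, (j <= n)%N -> expcoef (upto R m) (n - j) <= y ^+ j * expcoef (upto R m) n].
  case: m m0 mn {e0} => // m' _ mn; apply: expcoef_upto_growth.
  exact: leq_trans mn.
exists y; split=> // yq; rewrite ler_pdivrMr //.
(* w' is the part of the weight beyond m: its exponential is G_q *)
pose w' i : R := (m < i)%:R * mangoldt_weight F R m i.
have w'0 i : 0 <= w' i by rewrite mulr_ge0 ?mangoldt_weight_ge0.
have -> : expcoef (mangoldt_weight F R m) n = expcoef (fun i => w' i + upto R m i) n.
  apply: expcoef_eq => i /andP[i0 _]; rewrite /w' /upto ltnNge.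
  case: (leqP i m) => im; last by rewrite mul1r addr0.
  by rewrite mul0r add0r mangoldt_weight_upto // i0.
rewrite expcoefD.
apply: le_trans (_ : (\sum_(j < n.+1) expcoef w' j * y ^+ j) * expcoef (upto R m) n <= _).
  rewrite mulr_suml; apply: ler_sum => j _; rewrite -mulrA ler_wpM2l ?expcoef_ge0 //.
  by apply: ye; rewrite -ltnS.
rewrite ler_pM2r //.
under eq_bigr do rewrite -expcoefZ.
apply: le_trans (exp_partial_sum (b := fun i => w' i * y ^+ i) _ _ _ _ _) _.
- exact: expcoef0.
- by move=> i; apply: expcoef_ge0 => j; rewrite mulr_ge0 ?exprn_ge0 // ltW.
- by move=> i; rewrite mulr_ge0 ?exprn_ge0 // ltW.
- exact: expcoefS.
have yq' : 0 < y < q by rewrite y0.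
rewrite Gq_expR // ler_expR.
have -> : \sum_(i < n) w' i.+1 * y ^+ i.+1 / i.+1%:R =
   \sum_(i < n) (mangoldt F m i.+1)%:R * (y / q) ^+ i.+1 / i.+1%:R
   - \sum_(i < m) y ^+ i.+1 / i.+1%:R.
  rewrite (logsum_mangoldt F y (leqnn m)).
  rewrite [X in _ - X](big_ord_widen_cond n predT (fun i => (mangoldt F m i.+1)%:R * (y / q) ^+ i.+1 / i.+1%:R)) //.
  rewrite [X in _ - X]big_mkcond -sumrB; apply: eq_bigr => i _ /=.
  rewrite /w' /mangoldt_weight ltnS; case: (leqP m i) => im /=; last by rewrite mul0r mul0r mul0r subrr.
  by rewrite subr0 mul1r expr_div_n; congr (_ / _); rewrite mulrAC mulrA.
rewrite (logsum_mangoldt F y (leqnn m)) !sum_mangoldt /logG -sumrB; apply: ler_sum => d _.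
rewrite -mulrBr ler_wpM2l ?ler0n // /logtail lerB //.
apply: logsum_le; have /andP[/ltW -> ->] := expr_u_bounds d yq'; by [].
Qed.

End Ratio.

(** * Size of the saddle point *)

Section Saddle.
Variables (R : realType) (n m : nat).
Hypothesis mn : (1 <= m <= n)%N.
Local Notation x := (saddle R n m).

Lemma saddle_spec : 0 < x /\ \sum_(i < m) x ^+ i.+1 = n%:R.
Proof.
have /andP[m0 mn'] := mn; have n0 := leq_trans m0 mn'.
have [[x0 xE] _] := saddleP R n0 m0; split=> //.
by rewrite -xE big_add1 big_mkord.
Qed.

Lemma saddle_gt0 : 0 < x. Proof. by have [] := saddle_spec. Qed.

Lemma saddle_ge1 : 1 <= x.
Proof.
have [x0 xE] := saddle_spec; have /andP[m0 mn'] := mn.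
rewrite leNgt; apply/negP => x1.
have : n%:R < m%:R :> R; last by rewrite ltr_nat ltnNge mn'.
rewrite -xE -[m in ltRHS]card_ord -sumr_const.
apply: ltr_sum => [|i _]; first by apply/hasP; exists (Ordinal m0); rewrite ?mem_index_enum.
by rewrite exprn_ilt1 // ltW.
Qed.

Lemma saddle_expr_le : x ^+ m <= n%:R.
Proof.
have [x0 <-] := saddle_spec; have /andP[m0 _] := mn.
move: (x) x0 => t t0; case: (m) m0 => // m' _; rewrite big_ord_recr /= lerDr sumr_ge0 // => i _.
by rewrite exprn_ge0 // ltW.
Qed.

Lemma saddle_expr_ge : n%:R <= m%:R * x ^+ m.
Proof.
have [x0 <-] := saddle_spec; have x1 := saddle_ge1.
apply: le_trans (_ : \sum_(i < m) x ^+ m <= _).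
  by apply: ler_sum => i _; apply: ler_weXn2l.
by rewrite sumr_const card_ord mulr_natl.
Qed.

Lemma saddle_geometric : n%:R * (x - 1) <= x * x ^+ m.
Proof.
have [x0 <-] := saddle_spec.
have -> : (\sum_(i < m) x ^+ i.+1) * (x - 1) = x * (x ^+ m - 1).
  rewrite subrX1 [LHS]mulrC [RHS]mulrCA; congr (_ * _); rewrite mulr_sumr.
  by apply: eq_bigr => i _; rewrite exprS.
by rewrite mulrBr mulr1 gerBl ltW.
Qed.

End Saddle.

(** * The three regimes *)

Section Regimes.
Variables (R : realType).

Lemma expR_ge1 (t : R) : 0 <= t -> 1 <= expR t.
Proof. by have := expR_ge1Dx t; lra. Qed.

Lemma natr_expR n : (0 < n)%N -> n%:R = expR (ln n%:R) :> R.
Proof. by move=> n0; rewrite lnK // posrE ltr0n. Qed.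

Lemma natr_exp_expR q m : (0 < q)%N -> (q%:R : R) ^+ m = expR (m%:R * ln q%:R).
Proof. by move=> q0; rewrite {1}(natr_expR q0) expRM_natl. Qed.

Lemma ln2_ge : 2^-1 <= ln (2 : R).
Proof. by have := expR_ge1Dx (- ln 2 : R); rewrite expRN lnK ?posrE //; lra. Qed.

Lemma ln_q_ge q : (2 <= q)%N -> 2^-1 <= ln (q%:R : R).
Proof.
move=> q2; apply: le_trans ln2_ge _; rewrite ler_ln ?posrE ?ltr0n //.
  by rewrite (ler_nat _ 2).
exact: leq_trans q2.
Qed.

Lemma bernoulli20 m : m%:R <= 20 * (21 / 20) ^+ m :> R.
Proof.
suff : 1 + m%:R / 20 <= (21 / 20) ^+ m :> R by lra.
elim: m => [|m IH]; first by rewrite mul0r addr0.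
rewrite exprS -natr1.
have : (21 / 20 : R) * (1 + m%:R / 20) <= 21 / 20 * (21 / 20) ^+ m by rewrite ler_pM2l.
have : 0 <= m%:R :> R by [].
lra.
Qed.

(** Here q^m <= q^A n^2, so it suffices that n is at most a constant times x^m.
    For x bounded away from 1 this is saddle_geometric.  For x near 1, n is at
    most m x^m, hence so small a power of q^m that q^m itself is bounded. *)
Lemma saddle_pow_ge (q : nat) (A : R) : (2 <= q)%N -> 0 < A ->
  exists2 kap : R, 0 < kap <= 1 &
    forall n m : nat, (1 <= m <= n)%N -> m%:R - 2 * logb q (n%:R : R) <= A ->
      kap * q%:R ^+ m <= (saddle R n m ^+ m) ^+ 2.
Proof.
move=> q2 A0.
have q0 : (0 < q)%N by apply: leq_trans q2.
have lq := ln_q_ge q2.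
have lq0 : 0 < ln (q%:R : R) by lra.
pose QA := expR (A * ln q%:R).
have QA1 : 1 <= QA by rewrite /QA expR_ge1 // mulr_ge0 // ltW.
have [K KE] : exists K, K = 400 * QA by exists (400 * QA).
have KQ : 121 * QA <= K by rewrite KE ler_wpM2r //; lra.
have K1 : 1 <= K by lra.
have K20 : 0 < K ^+ 2 by rewrite exprn_gt0; lra.
exists (K ^- 2); first by rewrite invr_gt0 K20 invf_le1 // exprn_ege1.
move=> n m mn mA; have /andP[m0 mn'] := mn; have n0 := leq_trans m0 mn'.
have qm : q%:R ^+ m <= QA * n%:R ^+ 2.
  rewrite (natr_exp_expR m q0) (natr_exp_expR 2 n0) -expRD ler_expR.
  have : (m%:R - 2 * logb q (n%:R : R)) * ln q%:R <= A * ln q%:R by rewrite ler_wpM2r // ltW.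
  by rewrite mulrBl -mulrA /logb divfK ?gt_eqF //; lra.
have x1 := saddle_ge1 R mn; have ngeo := saddle_geometric R mn.
have nm := saddle_expr_ge R mn.
have X1 : 1 <= saddle R n m ^+ m by rewrite exprn_ege1.
set x := saddle R n m in x1 ngeo nm X1 *; set X := x ^+ m in ngeo nm X1 *.
rewrite mulrC ler_pdivrMr //.
have [x11|x11] := leP (11 / 10) x.
  have n11 : n%:R <= 11 * X.
    have x1' : 0 < x - 1 by lra.
    rewrite -(ler_pM2r x1'); apply: le_trans ngeo _.
    nra.
  apply: le_trans qm _.
  have nX : (n%:R : R) ^+ 2 <= (11 * X) ^+ 2.
    by apply: lerXn2r => //; rewrite nnegrE ?ler0n // (le_trans _ n11).
  apply: le_trans (_ : QA * (11 * X) ^+ 2 <= _).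
    by rewrite ler_wpM2l // (le_trans ler01).
  have -> : QA * (11 * X) ^+ 2 = X ^+ 2 * (121 * QA) by ring.
  rewrite ler_wpM2l ?sqr_ge0 //; apply: le_trans KQ _.
  by rewrite expr2 ler_peMl // (le_trans ler01).
(* b^4 <= 2 <= q makes n^4 = O(q^m), while q^m <= QA n^2; hence q^m = O(1).
   The factor 21/20 of b absorbs the m in n <= m x^m. *)
have [b [b0 b4 bE]] : exists b : R, [/\ 0 < b, b ^+ 4 <= 2 & 21 / 20 * (11 / 10) = b].
  exists (21 / 20 * (11 / 10)); split; [lra| |by []].
  by rewrite !exprS expr0; lra.
have bm0 : 0 < b ^+ m by rewrite exprn_gt0.
have n20 : n%:R <= 20 * b ^+ m :> R.
  apply: le_trans nm _; rewrite -bE exprMn mulrA.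
  apply: ler_pM; [by rewrite ler0n|lra|exact: bernoulli20|].
  by apply: lerXn2r; [rewrite nnegrE; lra|rewrite nnegrE; lra|exact: ltW].
pose s := (b ^+ m) ^+ 2.
have s0 : 0 < s by rewrite exprn_gt0.
have Qs : q%:R ^+ m <= K * s.
  apply: le_trans qm _.
  have -> : K * s = QA * (20 * b ^+ m) ^+ 2 by rewrite KE /s; ring.
  rewrite ler_wpM2l ?(le_trans ler01) // lerXn2r ?nnegrE ?ler0n //.
  exact: le_trans n20.
have sq : s ^+ 2 <= q%:R ^+ m.
  have -> : s ^+ 2 = (b ^+ 4) ^+ m by rewrite /s -!exprM (mulnC m).
  apply: lerXn2r; rewrite ?nnegrE ?ler0n ?exprn_ge0 ?(ltW b0) //.
  by apply: le_trans b4 _; rewrite (ler_nat _ 2).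
have Q0 : 0 < q%:R ^+ m :> R by rewrite exprn_gt0 // ltr0n.
have QQ : (q%:R ^+ m) ^+ 2 <= K ^+ 2 * q%:R ^+ m :> R.
  apply: le_trans (_ : (K * s) ^+ 2 <= _).
    apply: lerXn2r => //; rewrite nnegrE; first exact: ltW.
    exact: le_trans (ltW Q0) Qs.
  by rewrite exprMn ler_wpM2l ?sqr_ge0.
have Qle : q%:R ^+ m <= K ^+ 2 :> R by rewrite -(ler_pM2r Q0) -expr2.
by apply: le_trans Qle _; rewrite ler_peMl ?sqr_ge0 // exprn_ege1.
Qed.

Lemma Gq_ge_critical (q : nat) (A : R) : prime_power q -> 0 < A ->
   exists c : R, 0 < c /\
     forall (F : finFieldType) (n m : nat), #|F| = q ->
       (2 <= n)%N -> (1 <= m <= n)%N ->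
       `|m%:R - 2 * logb q (n%:R : R)| <= A ->
       saddle R n m < q%:R ->
       c <= Gq F m (saddle R n m) - 1.
Proof.
move=> [p [k [p_pr k0 qE]]] A0.
have q2 : (2 <= q)%N.
  by rewrite qE (leq_trans (prime_gt1 p_pr)) // -[leqLHS]expn1 leq_exp2l // prime_gt1.
have [kap kap01 kapP] := saddle_pow_ge q2 A0; have /andP[kap0 _] := kap01.
exists (kap / 8); split=> [|F n m Fq n2 mn mA xq]; first by rewrite divr_gt0.
have x0 := saddle_gt0 R mn; have /andP[m0 _] := mn.
have xq' : 0 < saddle R n m < #|F|%:R by rewrite x0 Fq.
have kx := kapP n m mn (le_trans (ler_norm _) mA).
rewrite Gq_expR // lerBrDl; apply: le_trans (expR_ge1Dx _).
rewrite lerD2l; apply: logG_ge_half => //; first by have /andP[/ltW -> ->] := kap01.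
rewrite Fq expr_div_n ler_pdivlMr ?exprn_gt0 ?ltr0n ?(leq_trans _ q2) //.
by rewrite [leRHS]exprAC.
Qed.

(** The factor 2 in the bound on z^m leaves room for both the saddle point and
    the ratio y of smooth_ratio_le_Gq.  Here W = log (q^m / n^2), and W >= log 4
    ensures z^2 <= q, so z/q <= 3/4. *)
Lemma Gq_near1 (F : finFieldType) (n m : nat) (z : R) :
  (0 < n)%N -> (0 < m)%N -> 0 < z -> z ^+ m <= 2 * n%:R ->
  let W := (m%:R - 2 * logb #|F| (n%:R : R)) * ln #|F|%:R in
  ln 4 <= W ->
  z < #|F|%:R /\ 1 <= Gq F m z <= expR (8 * expR (- (W / 2))).
Proof.
move=> n0 m0 z0 zm W W4; have q0 := q_gt0 R F; have q2 := q_ge2 R F.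
have q2n := card_field_gt1 F.
have lq := ln_q_ge q2n.
have WE : W = m%:R * ln #|F|%:R - 2 * ln n%:R.
  by rewrite /W mulrBl /logb -mulrA divfK // gt_eqF //; lra.
pose E := 2 * expR (- (W / 2)).
have E0 : 0 <= E by rewrite mulr_ge0 ?expR_ge0.
have E2 : E ^+ 2 = 4 * expR (- W).
  by rewrite exprMn -expRM_natl; congr (_ * expR _); [ring|field].
have zE : (z ^+ 2 / #|F|%:R) ^+ m <= E ^+ 2.
  rewrite E2 WE opprB expRB -!natr_exp_expR ?(ltn_trans _ q2n) //.
  rewrite expr_div_n mulrA ler_pM2r ?invr_gt0 ?exprn_gt0 // exprAC.
  have -> : 4 * n%:R ^+ 2 = (2 * n%:R) ^+ 2 :> R by ring.
  by rewrite ler_pXn2r ?nnegrE ?exprn_ge0 ?mulr_ge0 // ltW.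
have E1 : E ^+ 2 <= 1.
  rewrite E2 expRN ler_pdivrMr ?expR_gt0 // mul1r -[leLHS](@lnK _ 4) ?posrE //.
  by rewrite ler_expR.
have zq2 : z ^+ 2 <= #|F|%:R.
  rewrite -[leRHS]mul1r -ler_pdivrMr // leNgt; apply/negP => h.
  by have := le_trans zE E1; rewrite leNgt exprn_egt1 // => /negP[]; rewrite -lt0n.
have zq : z < #|F|%:R by nra.
have zq' : 0 < z < #|F|%:R by rewrite z0.
split=> //; rewrite Gq_expR // ler_expR expR_ge1 ?logG_ge0 //=.
have h := logG_le m0 zq' E0 (or_introl (conj zq2 zE)); apply: le_trans h _.
have u34 : z / #|F|%:R <= 3 / 4.
  rewrite ler_pdivrMr //; nra.
rewrite ler_pdivrMr; last lra.
have -> : 8 * expR (- (W / 2)) = 4 * E by rewrite /E; ring.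
nra.
Qed.

Lemma cvg_squeeze_exp (W f : nat -> R) :
  (W k @[k --> \oo] --> +oo)%classic ->
  (forall k, ln 4 <= W k -> 1 <= f k <= expR (8 * expR (- (W k / 2)))) ->
  (f k @[k --> \oo] --> (1 : R))%classic.
Proof.
move=> /cvgryPge Woo Wf; apply/cvgrPdist_le => e e0.
pose B : R := - 2 * ln (ln (1 + e) / 8).
near=> k.
have W4 : ln 4 <= W k by near: k; apply: Woo.
have WB : B <= W k by near: k; apply: Woo.
have /andP[f1 fW] := Wf k W4.
have le0 : 0 < ln (1 + e) by rewrite ln_gt0 // ltrDl.
have : f k <= 1 + e.
  apply: le_trans fW _; rewrite -[leRHS]lnK ?posrE ?addr_gt0 // ler_expR.
  rewrite mulrC -ler_pdivlMr // -[leRHS]lnK ?posrE ?divr_gt0 // ler_expR.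
  by move: WB; rewrite /B; lra.
by rewrite ler_norml; lra.
Unshelve. all: by end_near. Qed.

Lemma smooth_ratio_cvg1 (q n m : nat -> nat) (F : nat -> finFieldType) :
     (forall k, #|F k| = q k) ->
     (forall k, (2 <= n k)%N /\ (1 <= m k <= n k)%N) ->
     ((((m k)%:R - 2 * logb (q k) (n k)%:R) * ln (q k)%:R : R)
        @[k --> \oo] --> +oo)%classic ->
     (Gq (F k) (m k) (saddle R (n k) (m k)) @[k --> \oo] --> (1 : R))%classic /\
     (prob_poly_smooth R (F k) (n k) (m k) / prob_perm_smooth R (n k) (m k)
        @[k --> \oo] --> (1 : R))%classic.
Proof.
move=> Fq nm Woo; split; apply: (cvg_squeeze_exp Woo) => k;
  have [n2 mn] := nm k; have /andP[m0 mn'] := mn;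
  have n0 : (0 < n k)%N := leq_trans m0 mn'; rewrite -Fq => W4.
  have x0 := saddle_gt0 R mn.
  have xm : saddle R (n k) (m k) ^+ m k <= 2 * (n k)%:R.
    by apply: le_trans (saddle_expr_le R mn) _; rewrite ler_peMl // ler1n.
  by have [] := Gq_near1 n0 m0 x0 xm W4.
have [y [y0 ym yG]] := smooth_ratio_le_Gq R (F k) mn.
have ym' : y ^+ m k <= 2 * (n k)%:R.
  by apply: le_trans ym _; rewrite -natrM ler_nat mul2n -addnn leq_add2l.
have [yq /andP[_ Gy]] := Gq_near1 n0 m0 y0 ym' W4.
by rewrite smooth_ratio_ge1 //= (le_trans (yG yq)).
Qed.

(** Here n^a = n^2 q^-m.  The hypothesis on (1 - a) log n says q^m >= 2n, which
    forces u^m <= 1/2 and hence 1 - u >= 1/(2m), where u = x/q. *)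
Lemma logG_subcritical (F : finFieldType) (n m : nat) (a : R) :
  (2 <= n)%N -> (1 <= m <= n)%N ->
  a = 2 - m%:R / logb #|F| (n%:R : R) -> 0 < a ->
  ln 2 <= (1 - a) * ln n%:R ->
  let x := saddle R n m in
  x < #|F|%:R /\
  expR (a * ln n%:R) / (4 * m%:R ^+ 3) <= logG F m x <= 2 * m%:R * expR (a * ln n%:R).
Proof.
move=> n2 mn aE a0 ha x; have /andP[m0 mn'] := mn; have n0 := leq_trans m0 mn'.
have q0 := q_gt0 R F; have q2 := q_ge2 R F; have q2n := card_field_gt1 F.
have lq := ln_q_ge q2n; have ln0 := ln_q_ge n2.
have q0n : (0 < #|F|)%N := ltn_trans (ltn0Sn 0) q2n.
have at_ : a * ln n%:R = 2 * ln n%:R - m%:R * ln #|F|%:R.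
  by rewrite aE /logb invf_div; field; rewrite gt_eqF //; lra.
have Qm0 : 0 < #|F|%:R ^+ m :> R by rewrite exprn_gt0.
set Y := expR (a * ln n%:R).
have YE : Y = n%:R ^+ 2 / #|F|%:R ^+ m.
  by rewrite /Y at_ expRB (natr_exp_expR 2 n0) (natr_exp_expR m q0n).
have Y1 : 1 <= Y by rewrite /Y expR_ge1 // mulr_ge0 //; lra.
have x0 := saddle_gt0 R mn; have x1 := saddle_ge1 R mn.
have Xle := saddle_expr_le R mn; have Xge := saddle_expr_ge R mn.
rewrite -/x in x0 x1 Xle Xge.
have X0 : 0 < x ^+ m by rewrite exprn_gt0.
have um : (x / #|F|%:R) ^+ m <= 2^-1.
  rewrite expr_div_n; apply: le_trans (_ : n%:R / #|F|%:R ^+ m <= _).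
    by rewrite ler_pM2r // invr_gt0.
  rewrite {1}(natr_expR n0) (natr_exp_expR m q0n) -expRB -(@lnK _ 2) ?posrE //.
  by rewrite -expRN ler_expR; lra.
have u0 : 0 < x / #|F|%:R by rewrite divr_gt0.
have u1 : x / #|F|%:R < 1.
  rewrite ltNge; apply/negP => u1.
  by have := exprn_ege1 m u1; lra.
have xq : x < #|F|%:R by move: u1; rewrite ltr_pdivrMr // mul1r.
have xq' : 0 < x < #|F|%:R by rewrite x0.
have m0R : 0 < m%:R :> R by rewrite ltr0n.
have rE : (x ^+ 2 / #|F|%:R) ^+ m = (x ^+ m) ^+ 2 / #|F|%:R ^+ m.
  by rewrite expr_div_n exprAC.
split=> //; apply/andP; split.
  apply: le_trans (logG_ge_last m0 xq'); rewrite rE YE.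
  have -> : n%:R ^+ 2 / #|F|%:R ^+ m / (4 * m%:R ^+ 3) =
     (n%:R / m%:R) ^+ 2 / #|F|%:R ^+ m / (4 * m%:R) :> R.
    by field; rewrite !gt_eqF.
  rewrite ler_pM2r ?invr_gt0 ?mulr_gt0 // ler_pM2r ?invr_gt0 //.
  rewrite ler_pXn2r ?nnegrE ?divr_ge0 ?(ltW X0) //.
  by rewrite ler_pdivrMr // mulrC.
have XY : (x ^+ 2 / #|F|%:R) ^+ m <= Y.
  rewrite rE YE ler_pM2r ?invr_gt0 // ler_pXn2r ?nnegrE //; exact: ltW.
have Y0 : 0 <= Y by lra.
apply: le_trans (@logG_le _ _ _ _ Y m0 xq' Y0 _) _.
  have [h|h] := leP (x ^+ 2) #|F|%:R; [left|right]; split=> //; last exact: ltW.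
  by apply: le_trans XY _; rewrite expr2 ler_peMr.
have um2 : 2^-1 <= m%:R * (1 - x / #|F|%:R).
  move: um u0 u1; move: (x / #|F|%:R) => u um u0 u1.
  have : 1 - u ^+ m <= m%:R * (1 - u).
    rewrite -opprB subrX1 -mulNr opprB mulrC ler_wpM2r ?subr_ge0 ?(ltW u1) //.
    rewrite -[m in leRHS]card_ord -sumr_const; apply: ler_sum => i _.
    by rewrite exprn_ile1 // ltW.
  lra.
rewrite ler_pdivrMr; last lra.
nra.
Qed.

(** A quantitative form of log t = o(t), for the factors of m = O(log n). *)
Lemma ln_le_sqrt (t : R) : 0 < t -> ln (16 * t) <= 8 * Num.sqrt t.
Proof.
move=> t0; have s0 : 0 < Num.sqrt t by rewrite sqrtr_gt0.
have -> : 16 * t = (4 * Num.sqrt t) ^+ 2.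
  by rewrite exprMn sqr_sqrtr ?(ltW t0) //; ring.
rewrite lnXn ?mulr_gt0 // [ln _ *+ 2]mulr2n.
by have := @ln_sublinear R (4 * Num.sqrt t); rewrite mulr_gt0 // => /(_ isT); lra.
Qed.

Lemma near_ln_ge (B : R) : (\forall n \near \oo, B <= ln (n%:R : R))%classic.
Proof.
near=> n.
have : expR B <= n%:R by near: n; exact: nbhs_infty_ger.
move=> h; have n0 : 0 < n%:R :> R by apply: lt_le_trans h; rewrite expR_gt0.
by rewrite -ler_expR lnK.
Unshelve. all: by end_near. Qed.

(** The exponent delta is chosen to make the estimate an equality, so the
    constants are 1 and all the content is in delta -> 0. *)
Lemma logGq_subcritical (q : nat) (F : finFieldType) (eps : R) (m : nat -> nat) :
  #|F| = q -> 0 < eps < 1 ->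
  (forall n, (2 <= n)%N -> (1 <= m n <= n)%N) ->
  (((m n)%:R / logb q (n%:R : R)) @[n --> \oo] --> 2 - eps)%classic ->
  exists delta : nat -> R,
    (delta n @[n --> \oo] --> (0 : R))%classic /\
    (\forall n \near \oo,
      1 * n%:R `^ (eps + delta n)
        <= ln (Gq F (m n) (saddle R n (m n)))
        <= 1 * n%:R `^ (eps + delta n))%classic.
Proof.
move=> Fq /andP[e0 e1] mn mL; rewrite -Fq in mL.
pose L n := logG F (m n) (saddle R n (m n)).
pose a n : R := 2 - (m n)%:R / logb #|F| (n%:R : R).
exists (fun n => ln (L n) / ln n%:R - eps).
have near_a e : 0 < e -> (\forall n \near \oo, `|a n - eps| <= e)%classic.
  move=> e_gt0; have /cvgrPdist_le/(_ e e_gt0) := mL.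
  apply: filterS => n; rewrite /a; congr (`|_| <= _); ring.
pose good n := (2 <= n)%N /\ [/\ 0 < ln n%:R :> R, 0 < a n,
    saddle R n (m n) < #|F|%:R &
    expR (a n * ln n%:R) / (4 * (m n)%:R ^+ 3) <= L n
      <= 2 * (m n)%:R * expR (a n * ln n%:R)].
have key : (\forall n \near \oo, good n)%classic.
  near=> n.
  have n2 : (2 <= n)%N by near: n; exact: nbhs_infty_ge.
  have ae : `|a n - eps| <= eps / 2 by near: n; apply: near_a; lra.
  have ae' : `|a n - eps| <= (1 - eps) / 2 by near: n; apply: near_a; lra.
  have lnB : 2 / (1 - eps) * ln 2 <= ln (n%:R : R) by near: n; exact: near_ln_ge.
  have ln0 : 0 < ln (n%:R : R) by have := ln_q_ge n2; lra.
  move: ae ae'; rewrite !ler_norml => /andP[a1 a2] /andP[a3 a4].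
  have ha : ln 2 <= (1 - a n) * ln n%:R.
    have h1 : (1 - eps) / 2 * (2 / (1 - eps) * ln 2) <= (1 - eps) / 2 * ln (n%:R : R).
      by rewrite ler_pM2l //; lra.
    have h2 : (1 - eps) / 2 * (2 / (1 - eps) * ln 2) = ln 2 :> R.
      by field; rewrite gt_eqF //; lra.
    have h3 : (1 - eps) / 2 * ln (n%:R : R) <= (1 - a n) * ln n%:R.
      by rewrite ler_pM2r //; lra.
    lra.
  have a0 : 0 < a n by lra.
  have [xq LL] := logG_subcritical n2 (mn n n2) (erefl (a n)) a0 ha.
  by [].
split; last first.
  near=> n.
  have [n2 [ln0 _ xq /andP[Llo _]]] : good n by near: n; exact: key.
  have /andP[m0 _] := mn n n2.
  have x0 := saddle_gt0 R (mn n n2).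
  have L0 : 0 < L n.
    apply: lt_le_trans Llo; rewrite divr_gt0 ?expR_gt0 // mulr_gt0 // exprn_gt0 //.
    by rewrite ltr0n.
  have -> : ln (Gq F (m n) (saddle R n (m n))) = L n.
    by rewrite Gq_expR ?expRK // x0.
  have -> : n%:R `^ (eps + (ln (L n) / ln n%:R - eps)) = L n.
    rewrite /powR pnatr_eq0 -leqn0 leqNgt (leq_trans _ n2) //=.
    have -> : (eps + (ln (L n) / ln n%:R - eps)) * ln n%:R = ln (L n).
      by field; rewrite gt_eqF.
    by rewrite lnK.
  by rewrite mul1r lexx.
apply/cvgrPdist_le => e e_gt0.
near=> n.
have [n2 [ln0 a0 xq /andP[Llo Lhi]]] : good n by near: n; exact: key.
have ae : `|a n - eps| <= e / 2 by near: n; apply: near_a; lra.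
have tB : (48 / e) ^+ 2 <= ln (n%:R : R) by near: n; exact: near_ln_ge.
have /andP[m0 _] := mn n n2.
have m0R : 1 <= (m n)%:R :> R by rewrite ler1n.
have lq := ln_q_ge (card_field_gt1 F).
set t := ln (n%:R : R) in ln0 tB Llo Lhi *.
have m4 : 4 * (m n)%:R <= 16 * t.
  have : (m n)%:R / logb #|F| (n%:R : R) < 2 by move: a0; rewrite /a; lra.
  rewrite /logb -/t invf_div mulrA ltr_pdivrMr // => h.
  have : (m n)%:R * 2^-1 <= (m n)%:R * ln #|F|%:R :> R by rewrite ler_wpM2l.
  lra.
have l4 : ln (4 * (m n)%:R) <= 8 * Num.sqrt t.
  apply: le_trans (ln_le_sqrt ln0); rewrite ler_ln ?posrE ?mulr_gt0 //.
  by lra.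
have s0 : 0 < Num.sqrt t by rewrite sqrtr_gt0.
have sB : 48 <= e * Num.sqrt t.
  rewrite mulrC -ler_pdivrMr // -(@ler_pXn2r _ 2) ?nnegrE ?divr_ge0 ?(ltW s0) ?(ltW e_gt0) //.
  by rewrite sqr_sqrtr // ltW.
have m4p : 0 < 4 * (m n)%:R :> R by lra.
have m4pos : 0 < 4 * (m n)%:R ^+ 3 :> R by rewrite mulr_gt0 // exprn_gt0 //; lra.
have m2p : 0 < 2 * (m n)%:R :> R by lra.
have L0 : 0 < L n by apply: lt_le_trans Llo; rewrite divr_gt0 ?expR_gt0.
have lo : a n * t - 3 * ln (4 * (m n)%:R) <= ln (L n).
  apply: le_trans (_ : ln (expR (a n * t) / (4 * (m n)%:R ^+ 3)) <= _); last first.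
    by rewrite ler_ln ?posrE ?divr_gt0 ?expR_gt0.
  rewrite ln_div ?posrE ?expR_gt0 // expRK lerB //.
  have -> : 3 * ln (4 * (m n)%:R) = ln ((4 * (m n)%:R) ^+ 3) :> R.
    by rewrite lnXn // -[RHS]mulr_natl.
  rewrite ler_ln ?posrE ?exprn_gt0 // exprMn ler_pM2r ?exprn_gt0 //; last lra.
  by rewrite -[leLHS]expr1 ler_weXn2l //; lra.
have hi : ln (L n) <= a n * t + ln (4 * (m n)%:R).
  apply: le_trans (_ : ln (2 * (m n)%:R * expR (a n * t)) <= _).
    by rewrite ler_ln ?posrE // mulr_gt0 ?expR_gt0.
  rewrite lnM ?posrE ?expR_gt0 // expRK addrC lerD2l ler_ln ?posrE //; lra.
have ts : t = Num.sqrt t ^+ 2 by rewrite sqr_sqrtr // ltW.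
have l40 : 0 <= ln (4 * (m n)%:R : R) by rewrite ln_ge0 //; lra.
have d : `|ln (L n) / t - a n| <= e / 2.
  have -> : ln (L n) / t - a n = (ln (L n) - a n * t) / t by field; rewrite gt_eqF.
  rewrite normrM [`|t^-1|]gtr0_norm ?invr_gt0 // ler_pdivrMr // ler_norml.
  have : 24 * Num.sqrt t <= e / 2 * t.
    rewrite [X in _ <= _ * X]ts expr2 mulrA ler_pM2r //; lra.
  by move=> h; apply/andP; split; lra.
by move: d ae; rewrite !ler_norml => /andP[? ?] /andP[? ?]; apply/andP; split; lra.
Unshelve. all: by end_near. Qed.

End Regimes.

Unset Implicit Arguments.
Local Open Scope classical_set_scope.
Local Open Scope ring_scope.

Theorem theorem1p4 (R : realType) :
  (* (i) *)
  (forall (q n m : nat -> nat) (F : nat -> finFieldType),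
     (forall k, prime_power (q k)) ->
     (forall k, #|F k| = q k) ->
     (forall k, (2 <= n k)%N /\ (1 <= m k <= n k)%N) ->
     ((((m k)%:R - 2 * logb (q k) (n k)%:R) * ln (q k)%:R : R)
        @[k --> \oo] --> +oo) ->
     (Gq (F k) (m k) (saddle R (n k) (m k)) @[k --> \oo] --> (1 : R)) /\
     (prob_poly_smooth R (F k) (n k) (m k) / prob_perm_smooth R (n k) (m k)
        @[k --> \oo] --> (1 : R)))
  /\
  (* (ii) *)
  (forall (q : nat) (A : R), prime_power q -> 0 < A ->
     exists c : R, 0 < c /\
       forall (F : finFieldType) (n m : nat), #|F| = q ->
         (2 <= n)%N -> (1 <= m <= n)%N ->
         `|m%:R - 2 * logb q (n%:R : R)| <= A ->
         saddle R n m < q%:R ->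
         c <= Gq F m (saddle R n m) - 1)
  /\
  (* (iii) *)
  (forall q : nat, prime_power q ->
     exists c C : R, 0 < c <= C /\
       forall (F : finFieldType) (eps : R) (m : nat -> nat), #|F| = q ->
         0 < eps < 1 ->
         (forall n, (2 <= n)%N -> (1 <= m n <= n)%N) ->
         (((m n)%:R / logb q (n%:R : R)) @[n --> \oo] --> 2 - eps) ->
         exists delta : nat -> R,
           (delta n @[n --> \oo] --> (0 : R)) /\
           (\forall n \near \oo,
              c * n%:R `^ (eps + delta n)
                <= ln (Gq F (m n) (saddle R n (m n)))
                <= C * n%:R `^ (eps + delta n))).
Proof.
split; [|split].
- by move=> q n m F _ Fq nm; apply: smooth_ratio_cvg1.
- by move=> q A; apply: Gq_ge_critical.
- move=> q _; exists 1, 1; split; first by rewrite ltr01 lexx.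
  by move=> F eps m Fq; apply: logGq_subcritical.
Qed.
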